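(* Fix a prime power $q$, and let $n\ge d+1\ge 3$ be integers. Let $V=\mathbb F_q^n$ and let $\mathcal F$ be a family of subspaces of $V$ with $\mathrm{diam}(\mathcal F)\le d$. Then \[ |\mathcal F|\le \begin{cases} \displaystyle \sum_{i=0}^{t}\begin{bmatrix} n\\ i\end{bmatrix}_q, & \text{if } d=2t,\\[2mm] \displaystyle \sum_{i=0}^{t}\begin{bmatrix} n\\ i\end{bmatrix}_q+\begin{bmatrix} n-1\\ t\end{bmatrix}_q, & \text{if } d=2t+1. \end{cases} \] Moreover, equality holds if and only if, after possibly replacing $\mathcal F$ by $\mathcal F^\perp$, one of the following holds: (1) $n=d+1$ and $d=2t$, and for each $0\le k\le t$, either $|\mathcal F(k)|=\begin{bmatrix} n\\ k\end{bmatrix}_q$ and $|\mathcal F(n-k)|=0$, or $|\mathcal F(k)|=0$ and $|\mathcal F(n-k)|=\begin{bmatrix} n\\ k\end{bmatrix}_q$; (2) $n=d+1$ and $d=2t+1$, and for each $0\le k\le t$, either $|\mathcal F(k)|=\begin{bmatrix} n\\ k\end{bmatrix}_q$ and $|\mathcal F(n-k)|=0$, or $|\mathcal F(k)|=0$ and $|\mathcal F(n-k)|=\begin{bmatrix} n\\ k\end{bmatrix}_q$; moreover $|\mathcal F(t+1)|=\begin{bmatrix} n-1\\ t\end{bmatrix}_q$ and $\mathcal F(t+1)$ is $1$-intersecting in $V$; (3) $n\ge d+2$, $d=2t$, and $\mathcal F=\bigcup_{k=0}^{t}\mathcal V(k)$; (4) $n\ge d+2$, $d=2t+1$, and there exists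 a $1$-dimensional subspace $X$ of $V$ such that $\mathcal F=\bigcup_{k=0}^{t}\mathcal V(k)\cup\{A\in\mathcal V(t+1): X\le A\}$.
   Context: $V=\mathbb F_q^n$; $\mathcal V$ is the set of all subspaces of $V$ and $\mathcal V(k)$ the set of $k$-dimensional subspaces, so $|\mathcal V(k)|=\begin{bmatrix} n\\ k\end{bmatrix}_q=\prod_{i=0}^{k-1}\frac{q^{n-i}-1}{q^{k-i}-1}$ (Gaussian binomial coefficient). $U\le W$ means $U$ is a subspace of $W$. For subspaces $U,W$, $\Delta(U,W)=\dim(U+W)-\dim(U\cap W)$, and for $\mathcal F\subseteq\mathcal V$, $\mathrm{diam}(\mathcal F)=\max\{\Delta(U,W):U,W\in\mathcal F\}$ and $\mathcal F(k)=\mathcal F\cap\mathcal V(k)$. $U^\perp$ is the orthogonal complement of $U$ with respect to a fixed nondegenerate bilinear form on $V$, and $\mathcal F^\perp=\{U^\perp:U\in\mathcal F\}$. A family $\mathcal A\subseteq\mathcal V$ is $s$-intersecting in $V$ if $\dim(A\cap B)\ge s$ for all $A,B\in\mathcal A$. *)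

(* Defs.v *)
From HB Require Import structures.
From mathcomp Require Import all_boot all_order all_algebra.

Set Implicit Arguments.
Unset Strict Implicit.
Unset Printing Implicit Defensive.

Import GRing.Theory.
Local Open Scope ring_scope.

(* Needed for the subtype structure of {vspace vT}. *)
Import VectorInternalTheory.
HB.instance Definition _ (F : finFieldType) (vT : vectType F) :=
  [Countable of {vspace vT} by <:].
HB.instance Definition _ (F : finFieldType) (vT : vectType F) :=
  [Finite of {vspace vT} by <:].

(* Kept in rat, so the quotient needs no exactness argument; the truncated
   subtractions only matter for k > n, where the factor i = n makes the
   product 0. *)
Definition gauss_binom (q n k : nat) : rat :=
  \prod_(i < k) ((q%:R ^+ (n - i) - 1) / (q%:R ^+ (k - i) - 1)).

Section SubspaceFamilies.
Variables (F : finFieldType) (n : nat).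
Local Notation V := 'rV[F]_n.
Local Notation q := #|F|.
Implicit Types (U W X A : {vspace V}) (fam : {set {vspace V}}).

Definition subspaces (k : nat) : {set {vspace V}} := [set U | \dim U == k].

Definition layer fam (k : nat) : {set {vspace V}} := fam :&: subspaces k.

Definition delta U W : nat := (\dim (U + W) - \dim (U :&: W))%N.

(* The empty family gets diameter 0. *)
Definition diam fam : nat := \max_(U in fam) \max_(W in fam) delta U W.

Definition intersecting (s : nat) fam : Prop :=
  forall A B, A \in fam -> B \in fam -> (s <= \dim (A :&: B))%N.

Definition nondegenerate_form (b : {biscalar V}) : Prop :=
  forall u, (forall v, b u v = 0) -> u = 0.

(* As b need not be reflexive, a side has to be chosen: this is
   {u | b u v = 0 for all v in U}, see mem_perp. *)
Definition perp (b : {biscalar V}) U : {vspace V} :=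
  (\bigcap_(v : V | v \in U) lker (linfun (applyr b v : V -> F^o)))%VS.

Lemma mem_perp (b : {biscalar V}) U u :
  reflect (forall v, v \in U -> b u v = 0) (u \in perp b U).
Proof.
apply: (iffP subv_bigcapP) => h v Uv.
  by have := h v Uv; rewrite -memvE memv_ker lfunE => /eqP.
by rewrite -memvE memv_ker lfunE; apply/eqP/h.
Qed.

Definition perp_family (b : {biscalar V}) fam : {set {vspace V}} :=
  [set perp b U | U in fam].

(* The bound for d = 2t or d = 2t + 1, with t = d./2. *)
Definition diam_bound (d : nat) : rat :=
  \sum_(i < d./2.+1) gauss_binom q n i
    + (if odd d then gauss_binom q n.-1 d./2 else 0).

Definition one_of_two_layers fam (k : nat) : Prop :=
     #|layer fam k|%:R = gauss_binom q n k /\ #|layer fam (n - k)| = 0%N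
  \/ #|layer fam k| = 0%N /\ #|layer fam (n - k)|%:R = gauss_binom q n k.

Definition extremal1 (d t : nat) fam : Prop :=
  [/\ n = d.+1, d = (2 * t)%N
    & forall k, (k <= t)%N -> one_of_two_layers fam k].

Definition extremal2 (d t : nat) fam : Prop :=
  [/\ n = d.+1, d = (2 * t).+1,
      forall k, (k <= t)%N -> one_of_two_layers fam k,
      #|layer fam t.+1|%:R = gauss_binom q n.-1 t
    & intersecting 1 (layer fam t.+1)].

Definition extremal3 (d t : nat) fam : Prop :=
  [/\ (d.+2 <= n)%N, d = (2 * t)%N & fam = \bigcup_(k < t.+1) subspaces k].

Definition extremal4 (d t : nat) fam : Prop :=
  [/\ (d.+2 <= n)%N, d = (2 * t).+1
    & exists2 X, \dim X = 1%N
      & fam = (\bigcup_(k < t.+1) subspaces k)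
                :|: [set A in subspaces t.+1 | (X <= A)%VS]].

Definition extremal (d : nat) fam : Prop :=
  exists t, [\/ extremal1 d t fam, extremal2 d t fam,
                extremal3 d t fam | extremal4 d t fam].

End SubspaceFamilies.

Arguments diam_bound F n d : clear implicits.

(* Main.v *)
Require Import Defs.
From HB Require Import structures.
From mathcomp Require Import all_boot all_order all_algebra.
From mathcomp Require Import all_field.
From mathcomp Require Import zify ring lra.

(** Let t = d./2.  Members of the layers k and n - k intersect because d < n;
    averaging a pair of complementary subspaces over GL_n therefore bounds the
    sum of the two layers by the Gaussian binomial [n,k], and since any two
    subspaces of equal dimension have a common complement, equality forces one
    of the two layers to be full.  This leaves the layers t < k < n - t.

    The basic bound for them is the Erdős-Ko-Rado theorem: V is partitioned into
    q^(n-k) subspaces of dimension k and one of dimension n - k, at most one of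
    which is a member or a superspace of a member; a Kruskal-Katona bound for
    upper shadows then gives the sharp constant, and its equality case the
    uniqueness of stars.

    For n = d + 1 this finishes the proof.  For n >= d + 2 a member in a middle
    layer forces the layers t and n - t to be small, as all their members meet
    it; the other middle layers are controlled by averaging over lifted
    Gabidulin codes when t >= 2, and by the structure of families of k-spaces
    meeting pairwise in dimension k - 1 when t = 1.  Hence equality leaves no
    room for middle layers, except for a star in dimension t + 1 when d is odd. *)

Set Implicit Arguments.
Unset Strict Implicit.
Unset Printing Implicit Defensive.

Import Order.TTheory GRing.Theory Num.Theory.
Local Open Scope ring_scope.

(* [lia] on the arithmetic hypotheses only: the others make it very slow. *)
Ltac nlia :=
  repeat match goal with
  | H : is_true (leq _ _) |- _ => revert H
  | H : is_true (andb (leq _ _) (leq _ _)) |- _ => revert H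
  | H : @eq ?T _ _ |- _ => unify T nat; revert H
  end; clear; lia.

(** * Gaussian binomial coefficients *)

(** For t < k < n - t the bound [n,k] on two complementary layers is useless, as it exceeds [n,t].
    What must be controlled is [core], the layers t to n - t together: once it is strictly below
    [n,t] (plus [n-1,t] for odd d), the outer pairs do the rest. A member of dimension m that meets
    all t-dimensional members leaves at most [m,1][n-1,t-1] of them, one star per point of that
    member; this is what shrinks the layers t and n - t.

    The code bound on a layer k > t is (q/(q^(t+1)-1))^(k-t) [n,t]. For t >= 2 the ratio is at most
    2/7, and the layers from t + 2 on cost at most 4/35 of [n,t] from each end; their sum 8/35 is
    just below a quarter, so that more than three quarters are left for the other four layers. For t
    = 1 and q = 2 the ratio is 2/3 and the series is far too large, hence separate arguments for d =
    2 and d = 3.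

    Orthogonal complements exchange the layers k and n - k, so bounds on low layers serve for high
    ones. *)

Section GaussBinom.
Variable q : nat.
Hypothesis q_gt1 : (1 < q)%N.
Local Notation G := (gauss_binom q).
Local Notation Q := (q%:R : rat).

Lemma q_ge2 : 2 <= Q.
Proof. by rewrite (ler_nat _ 2). Qed.

Lemma expq_ge1 k : 1 <= Q ^+ k.
Proof. by rewrite exprn_ege1 // (ler_nat _ 1) ltnW. Qed.

Lemma expq_gt1 k : (0 < k)%N -> 1 < Q ^+ k.
Proof. by move=> k0; rewrite exprn_egt1 -?lt0n // (ltr_nat _ 1). Qed.

Lemma expqB1_gt0 k : (0 < k)%N -> 0 < Q ^+ k - 1.
Proof. by move=> k0; rewrite subr_gt0 expq_gt1. Qed.

Lemma expqB1_neq0 k : (0 < k)%N -> Q ^+ k - 1 != 0.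
Proof. by move=> k0; rewrite gt_eqF // expqB1_gt0. Qed.

Lemma expqB1_ge0 k : 0 <= Q ^+ k - 1.
Proof. by rewrite subr_ge0 expq_ge1. Qed.

Lemma gaussn0 n : G n 0 = 1.
Proof. by rewrite /gauss_binom big_ord0. Qed.

(** Splits off the factor i = 0 of the product. With [gauss_ratio], which moves only the lower
    index, it reduces Pascal's rules to [ring] after multiplication by a nonzero q^k - 1. *)
Lemma gaussSS n k : G n.+1 k.+1 * (Q ^+ k.+1 - 1) = (Q ^+ n.+1 - 1) * G n k.
Proof.
rewrite /gauss_binom big_ord_recl !subn0 /= mulrAC divfK ?expqB1_neq0 //.
Qed.

Lemma gauss_small n k : (n < k)%N -> G n k = 0.
Proof.
move=> ltnk; rewrite /gauss_binom (bigD1 (Ordinal ltnk)) //= subnn.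
by rewrite expr0 subrr mul0r mul0r.
Qed.

Lemma gauss_ge0 n k : 0 <= G n k.
Proof. by apply: prodr_ge0 => i _; rewrite divr_ge0 ?expqB1_ge0. Qed.

Lemma gauss_gt0 n k : (k <= n)%N -> 0 < G n k.
Proof.
by move=> lekn; apply: prodr_gt0 => i _; rewrite divr_gt0 ?expqB1_gt0 //;
  have := ltn_ord i; lia.
Qed.

Lemma gauss1 n : G n 1 * (Q - 1) = Q ^+ n - 1.
Proof.
case: n => [|n]; first by rewrite gauss_small // mul0r expr0 subrr.
by rewrite -[X in X - 1]expr1 gaussSS gaussn0 mulr1 .
Qed.

Lemma gauss1S n : G n.+1 1 = 1 + Q * G n 1.
Proof.
apply: (@mulIf _ (Q - 1)); first by rewrite -[Q]expr1 expqB1_neq0.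
by rewrite gauss1 [RHS]mulrDl -mulrA gauss1 exprS; ring.
Qed.

Lemma gauss_ratio n k : (k <= n)%N ->
  G n k.+1 * (Q ^+ k.+1 - 1) = G n k * (Q ^+ (n - k) - 1).
Proof.
elim: k n => [|k IH] n; first by rewrite gaussn0 gauss1 subn0 mul1r.
case: n => // n; rewrite ltnS => lekn; rewrite subSS.
apply: (@mulIf _ (Q ^+ k.+1 - 1)); first exact: expqB1_neq0.
rewrite gaussSS -mulrA IH // (mulrC (G n.+1 _)) -mulrA gaussSS; ring.
Qed.

Lemma gauss_pascalr n k : (k <= n)%N ->
  G n.+1 k.+1 = G n k.+1 + Q ^+ (n - k) * G n k.
Proof.
move=> lekn; apply: (@mulIf _ (Q ^+ k.+1 - 1)); first exact: expqB1_neq0.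
rewrite gaussSS [RHS]mulrDl gauss_ratio // -{1}(subnK lekn) -addnS exprD; ring.
Qed.

Lemma gauss_pascall n k : (k <= n)%N ->
  G n.+1 k.+1 = Q ^+ k.+1 * G n k.+1 + G n k.
Proof.
move=> lekn; apply: (@mulIf _ (Q ^+ k.+1 - 1)); first exact: expqB1_neq0.
rewrite gaussSS [RHS]mulrDl -mulrA gauss_ratio // -{1}(subnK lekn) -addnS exprD; ring.
Qed.

Lemma gaussnn n : G n n = 1.
Proof.
elim: n => [|n IH]; first exact: gaussn0.
by rewrite gauss_pascalr // gauss_small // subnn IH mulr1 add0r.
Qed.

Lemma gauss_sym n k : (k <= n)%N -> G n (n - k) = G n k.
Proof.
elim: n k => [|n IH] [|k] //; first by rewrite subn0 gaussnn gaussn0.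
rewrite ltnS => lekn; rewrite subSS gauss_pascalr //.
have [->|ltkn] := eqVneq k n; first by rewrite subnn !gaussn0 gaussnn gauss_small // add0r mulr1.
have -> : (n - k = (n - k.+1).+1)%N by lia.
by rewrite gauss_pascall ?leq_subr //= -subSn ?subSS ?IH //; [rewrite addrC|lia..].
Qed.

Lemma gauss1_le m n : (m <= n)%N -> G m 1 <= G n 1.
Proof.
elim: n => [|n IH]; first by rewrite leqn0 => /eqP ->.
rewrite leq_eqVlt ltnS => /predU1P[-> //|/IH/le_trans->//].
rewrite gauss1S; have := q_ge2; have := gauss_ge0 n 1; nra.
Qed.

(** Holds for every q; the additive 1 supplies strictness in the estimates for d = 2 and d = 3. *)
Lemma gauss1_double n : 1 + 2 * G n 1 <= G n.+1 1.
Proof. by rewrite gauss1S; have := q_ge2; have := gauss_ge0 n 1; nra. Qed.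

End GaussBinom.

(** * Counting subspaces *)

Lemma double_count (T1 T2 : finType) (R : T1 -> T2 -> bool)
    (S1 : {set T1}) (S2 : {set T2}) :
  (\sum_(x in S1) #|[set y in S2 | R x y]| =
   \sum_(y in S2) #|[set x in S1 | R x y]|)%N.
Proof.
transitivity (\sum_(x in S1) \sum_(y in S2 | R x y) 1)%N.
  by apply: eq_bigr => x _; rewrite -sum1dep_card; apply: eq_bigl => y; rewrite ?inE.
rewrite (exchange_big_dep (mem S2)) /=; last by move=> x y _ /andP[].
by apply: eq_bigr => y yS; rewrite -sum1dep_card; apply: eq_bigl => x; rewrite yS.
Qed.

Section Subspaces.
Variables (F : finFieldType) (n : nat).
Local Notation V := 'rV[F]_n.
Local Notation q := #|F|.
Local Notation G := (gauss_binom q).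
Local Notation Q := (q%:R : rat).
Implicit Types (A B U W X E H : {vspace V}) (S : {set {vspace V}}).

Lemma card_field_gt1 : (1 < q)%N.
Proof. exact: finNzRing_gt1. Qed.
Local Notation q1 := card_field_gt1.

Lemma dim_rV : \dim {: V} = n.
Proof. by rewrite dimvf /dim /= mul1n. Qed.

Lemma dim_le U : (\dim U <= n)%N.
Proof. by have := dimvS (subvf U); rewrite dim_rV. Qed.

Lemma dim_add_line U v : v \notin U -> \dim (U + <[v]>) = (\dim U).+1.
Proof.
move=> vU; have := dimv_sum_cap U <[v]>.
have v0 : v != 0 by apply: contraNneq vU => ->; rewrite mem0v.
suff -> : (U :&: <[v]> = 0)%VS by rewrite dimv0 dim_vline v0; nlia.
apply/eqP; rewrite -subv0; apply/subvP => x; rewrite memv_cap => /andP[xU].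
case/vlineP => a def_x; rewrite def_x in xU *.
have [->|a0] := eqVneq a 0; first by rewrite scale0r mem0v.
by rewrite -[v](scalerK a0) memvZ in vU.
Qed.

Definition btw X E (k : nat) : {set {vspace V}} :=
  [set A | [&& (X <= A)%VS, (A <= E)%VS & \dim A == k]].

Lemma in_btw X E k A :
  (A \in btw X E k) = [&& (X <= A)%VS, (A <= E)%VS & \dim A == k].
Proof. by rewrite inE. Qed.

Lemma card_setD_vspace U W : (U <= W)%VS ->
  #|[set v : V | (v \in W) && (v \notin U)]|%:R = Q ^+ \dim W - Q ^+ \dim U.
Proof.
move=> sUW; rewrite -!natrX -!card_vspace.
have -> : [set v : V | (v \in W) && (v \notin U)] = [set v in W] :\: [set v in U].
  by apply/setP => v; rewrite !inE andbC.
have sS : [set v in U] \subset [set v in W].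
  by apply/subsetP => v; rewrite !inE; apply: (subvP sUW).
by rewrite cardsDS // natrB ?subset_leq_card // !cardsE.
Qed.

(** Induction on k - dim X, counting pairs (A, v) with v in A but not in X: each A accounts for q^k
    - q^(dim X) vectors, and each v in E outside X leaves the interval above X + <v>. *)
Lemma card_btw X E k : (X <= E)%VS -> (\dim X <= k)%N ->
  #|btw X E k|%:R = G (\dim E - \dim X) (k - \dim X).
Proof.
move: {2}(k - _)%N (erefl (k - \dim X)%N) => j.
elim: j X => [|j IH] X def_j sXE leXk.
  have <- : \dim X = k by nlia.
  rewrite subnn gaussn0 (_ : btw _ _ _ = [set X]) ?cards1 //.
  apply/setP => A; rewrite !inE; apply/and3P/eqP => [[sXA _ /eqP dA]|->].
    by apply/eqP; rewrite eq_sym eqEdim sXA dA /=.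
  by split.
have ltXk : (\dim X < k)%N by nlia.
have Qk : Q ^+ k - Q ^+ \dim X != 0.
  by rewrite subr_eq0 gt_eqF // ltr_eXn2l // (ltr_nat _ 1) q1.
apply: (mulIf Qk).
have := congr1 (fun m : nat => m%:R : rat)
  (double_count (fun A (v : V) => (v \in A) && (v \notin X)) (btw X E k)
     [set v : V | (v \in E) && (v \notin X)]).
rewrite /= !natr_sum.
rewrite [X in X = _ -> _](eq_bigr (fun=> Q ^+ k - Q ^+ \dim X)); last first.
  move=> A; rewrite in_btw => /and3P[sXA sAE /eqP <-].
  rewrite -card_setD_vspace //; congr (_%:R); apply: eq_card => v; rewrite !inE.
  by have [vA|] := boolP (v \in A); rewrite ?andbF // (subvP sAE _ vA) /= andbb.
rewrite [X in _ = X -> _](eq_bigr (fun=> G (\dim E - \dim X).-1 j)); last first.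
  move=> v; rewrite inE => /andP[vE vX].
  have dXv := dim_add_line vX.
  have -> : [set A in btw X E k | (v \in A) && (v \notin X)]
            = btw (X + <[v]>) E k.
    apply/setP => A; rewrite !inE vX andbT subv_add -memvE.
    by do 2!case: (_ <= _)%VS; case: (v \in A); case: (_ == _).
  rewrite IH ?dXv ?subv_add -?memvE ?sXE //; [|nlia..].
  by congr (G _ _); nlia.
rewrite !big_const !iter_addr !addr0 -[RHS]mulr_natr -[LHS]mulr_natl.
move=> ->; rewrite card_setD_vspace // def_j.
have [eqXE|ltXE] := leqP (\dim E) (\dim X).
  have -> : \dim E = \dim X by apply/eqP; rewrite eqn_leq eqXE dimvS.
  by rewrite subnn subrr mulr0 gauss_small // mul0r.
have -> : Q ^+ \dim E - Q ^+ \dim X = (Q ^+ (\dim E - \dim X).-1.+1 - 1) * Q ^+ \dim X.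
  by rewrite mulrBl mul1r -exprD; congr (_ ^+ _ - _); nlia.
have -> : Q ^+ k - Q ^+ \dim X = (Q ^+ j.+1 - 1) * Q ^+ \dim X.
  by rewrite mulrBl mul1r -exprD -def_j; congr (_ ^+ _ - _); nlia.
rewrite [in RHS](_ : (\dim E - \dim X = (\dim E - \dim X).-1.+1)%N); last nlia.
by rewrite [RHS]mulrA gaussSS ?q1 //; ring.
Qed.

Lemma btw_ex X E k : (X <= E)%VS -> (\dim X <= k <= \dim E)%N ->
  exists A, [/\ (X <= A)%VS, (A <= E)%VS & \dim A = k].
Proof.
move=> sXE /andP[leXk lekE].
have : 0 < #|btw X E k|%:R :> rat.
  by rewrite card_btw // gauss_gt0 ?q1 //; nlia.
rewrite ltr0n card_gt0 => /set0Pn[A]; rewrite in_btw => /and3P[? ? /eqP ?].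
by exists A.
Qed.

Lemma card_subspaces k : #|subspaces F n k|%:R = G n k.
Proof.
rewrite (_ : subspaces F n k = btw 0 fullv k).
  by rewrite card_btw ?sub0v ?dimv0 // dim_rV !subn0.
by apply/setP => A; rewrite !inE sub0v subvf.
Qed.

Lemma card_star X k : \dim X = 1%N ->
  #|[set A in subspaces F n k.+1 | (X <= A)%VS]|%:R = G n.-1 k.
Proof.
move=> dX; rewrite (_ : [set A in _ | _] = btw X fullv k.+1).
  by rewrite card_btw ?subvf ?dX // dim_rV !subn1.
by apply/setP => A; rewrite !inE subvf /= andbC.
Qed.

End Subspaces.

(** * Upper shadows *)

Section UpperShadow.
Variables (F : finFieldType) (n : nat).
Local Notation V := 'rV[F]_n.
Local Notation q := #|F|.
Local Notation G := (gauss_binom q).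
Local Notation Q := (q%:R : rat).
Local Notation q1 := (card_field_gt1 F).
Implicit Types (A B U W X E H : {vspace V}) (S T : {set {vspace V}}).

Definition up E S (k : nat) : {set {vspace V}} :=
  [set W | [&& (W <= E)%VS, \dim W == k & [exists A in S, (A <= W)%VS]]].

Definition restr S H : {set {vspace V}} := [set A in S | (A <= H)%VS].

Lemma upP E S k W :
  reflect [/\ (W <= E)%VS, \dim W = k & exists2 A, A \in S & (A <= W)%VS]
          (W \in up E S k).
Proof.
rewrite inE; apply: (iffP and3P) => [[sWE /eqP dW /exists_inP ?]|[sWE dW ?]].
  by split.
by split=> //; [rewrite dW | apply/exists_inP].
Qed.

Lemma restr_btw S X H E k : (H <= E)%VS ->
  S \subset btw X E k -> restr S H \subset btw X H k.
Proof.
move=> sHE /subsetP sS; apply/subsetP => A; rewrite inE => /andP[/sS].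
by rewrite !in_btw => /and3P[-> _ ->] ->.
Qed.

Lemma dim_cap_hyper E H W : (H <= E)%VS -> \dim E = (\dim H).+1 ->
  (W <= E)%VS -> ~~ (W <= H)%VS -> \dim W = (\dim (W :&: H)).+1.
Proof.
move=> sHE dE sWE sWH; have := dimv_sum_cap W H.
have sWHE : (W + H <= E)%VS by rewrite subv_add sWE.
have : (\dim (W + H) <= \dim E)%N by apply: dimvS.
have : (\dim H < \dim (W + H))%N.
  rewrite ltn_neqAle dimvS ?addvSr // andbT; apply: contra sWH => /eqP eqd.
  apply: subv_trans (addvSl W H) _.
  by have := dimv_leqif_sup (addvSr W H); rewrite /leqif eqd eqxx => -[_ <-].
nlia.
Qed.

(** The part of the shadow that sticks out of H: the trace on H puts W into the shadow and tells
    which member it came from, so this part can be counted exactly. *)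
Definition upout E H S (k : nat) : {set {vspace V}} :=
  [set W in btw 0 E k | ~~ (W <= H)%VS && ((W :&: H)%VS \in S)].

Lemma upout_up E H S k : upout E H S k \subset up E S k.
Proof.
apply/subsetP => W; rewrite inE in_btw => /andP[/and3P[_ sWE /eqP dW] /andP[_ WS]].
by apply/upP; split=> //; exists (W :&: H)%VS => //; rewrite capvSl.
Qed.

(** The fibre of W |-> [W :&: H] over A consists of the (k+1)-spaces of E through A that leave H;
    with e = dim H these are [e+1-k,1] - [e-k,1] = q^(e-k) in number. *)
Lemma card_upout E H S k : (H <= E)%VS -> \dim E = (\dim H).+1 ->
  (k <= \dim H)%N -> S \subset btw 0 E k ->
  #|upout E H S k.+1|%:R = Q ^+ (\dim H - k) * #|restr S H|%:R.
Proof.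
move=> sHE dE lekH /subsetP sS; have dcap := dim_cap_hyper sHE dE.
set D := upout _ _ _ _.
have := double_count (fun A W => (W :&: H)%VS == A) (restr S H) D.
rewrite [X in _ = X -> _](eq_bigr (fun=> 1%N)); last first.
  move=> W; rewrite inE => /andP[_ /andP[_ WS]].
  rewrite (_ : [set _ in _ | _] = [set (W :&: H)%VS]) ?cards1 //.
  apply/setP => A; rewrite !inE eq_sym; have [->|] := eqVneq; last by rewrite andbF.
  by rewrite WS capvSr.
rewrite sum1_card => /(congr1 (fun m : nat => m%:R : rat)) <-.
rewrite natr_sum (eq_bigr (fun=> Q ^+ (\dim H - k))); last first.
  move=> A; rewrite inE => /andP[AS sAH].
  have := sS _ AS; rewrite in_btw => /and3P[_ sAE /eqP dA].
  rewrite (_ : [set _ in _ | _] = btw A E k.+1 :\: btw A H k.+1).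
    rewrite cardsDS ?natrB ?subset_leq_card //; last 2 first.
    - by apply/subsetP => W; rewrite !in_btw => /and3P[-> /subv_trans->].
    - by apply/subsetP => W; rewrite !in_btw => /and3P[-> /subv_trans->].
    rewrite !card_btw ?dA ?leqW // dE subSn // subSnn gauss1S ?q1 //.
    apply: (@mulIf _ (Q - 1)); first by rewrite -[Q]expr1 expqB1_neq0 ?q1.
    rewrite mulrBl mulrDl -mulrA !gauss1 ?q1 //; ring.
  apply/setP => W; rewrite !inE sub0v /=.
  have [sWH|sWH] /= := boolP (W <= H)%VS.
    by case: (A <= W)%VS; case: (\dim W == _); rewrite /= ?andbF.
  have [sWE|] /= := boolP (W <= E)%VS; last by rewrite ?andbF.
  have [/eqP dW|] /= := boolP (\dim W == k.+1); last by rewrite ?andbF.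
  rewrite andbF !andbT /=; apply/andP/idP => [[_ /eqP <-]|sAW].
    exact: capvSl.
  suff eqA : (W :&: H)%VS = A by rewrite eqA eqxx.
  apply/eqP; rewrite eq_sym eqEdim subv_cap sAW sAH dA /=.
  by have := dcap _ sWE sWH; nlia.
by rewrite big_const iter_addr addr0 mulr_natr.
Qed.

(** The shadow inside H and [upout] are disjoint. The two terms match those of [gauss_pascalr], so a
    bound by Gaussian binomials passes from H to E without loss. *)
Lemma up_split E H S k : (H <= E)%VS -> \dim E = (\dim H).+1 ->
  (k <= \dim H)%N -> S \subset btw 0 E k ->
  #|up H (restr S H) k.+1|%:R + Q ^+ (\dim H - k) * #|restr S H|%:R
    <= #|up E S k.+1|%:R.
Proof.
move=> sHE dE lekH sS; rewrite -(card_upout sHE dE lekH sS) -natrD ler_nat.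
set D := upout _ _ _ _.
have dis : [disjoint up H (restr S H) k.+1 & D].
  apply/pred0P => W /=; apply/negP => /andP[/upP[sWH _ _]].
  by rewrite inE sWH andbF.
have <- : #|up H (restr S H) k.+1 :|: D| = (#|up H (restr S H) k.+1| + #|D|)%N.
  by rewrite cardsU (disjoint_setI0 dis) cards0 subn0.
apply/subset_leq_card/subsetP => W; rewrite inE => /orP[/upP[sWH dW [A]]|].
  rewrite inE => /andP[AS _] sAW; apply/upP; split=> //; last by exists A.
  exact: subv_trans sHE.
exact: (subsetP (upout_up _ _ _ _)).
Qed.

Lemma sum_restr E S k : (k < \dim E)%N -> S \subset btw 0 E k ->
  \sum_(H in btw 0 E (\dim E).-1) #|restr S H|%:R
    = #|S|%:R * G (\dim E - k) 1.
Proof.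
move=> ltkE /subsetP sS.
have := double_count (fun H A => (A <= H)%VS) (btw 0 E (\dim E).-1) S.
move/(congr1 (fun m : nat => m%:R : rat)); rewrite !natr_sum => ->.
rewrite (eq_bigr (fun=> G (\dim E - k) 1)); last first.
  move=> A /sS; rewrite in_btw => /and3P[_ sAE /eqP dA].
  rewrite (_ : [set _ in _ | _] = btw A E (\dim E).-1).
    rewrite card_btw ?dA //; last nlia.
    rewrite -[RHS]gauss_sym ?q1 //; last nlia.
    by congr (G _ _); nlia.
  apply/setP => H; rewrite !inE sub0v /=.
  by case: (A <= H)%VS; rewrite ?andbT ?andbF.
by rewrite big_const iter_addr addr0 mulr_natl.
Qed.

Lemma sum_up E S k : (k.+1 < \dim E)%N ->
  \sum_(H in btw 0 E (\dim E).-1) #|up H (restr S H) k.+1|%:R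
    <= #|up E S k.+1|%:R * G (\dim E - k.+1) 1.
Proof.
move=> ltkE; rewrite -sum_restr //; last first.
  by apply/subsetP => W /upP[sWE dW _]; rewrite in_btw sub0v sWE dW eqxx.
apply: ler_sum => H; rewrite in_btw => /and3P[_ sHE _].
rewrite ler_nat; apply/subset_leq_card/subsetP => W /upP[sWH dW [A]].
rewrite inE => /andP[AS _] sAW; rewrite inE sWH andbT.
by apply/upP; split=> //; [apply: subv_trans sHE | exists A].
Qed.

(** Sum over the hyperplanes of E, with e = dim E: a member lies in [e-k,1] of them, and a space of
    the shadow is counted at most [e-k-1,1] times. The quotient of these numbers turns the exponent
    e - k - 1 into e - k. Strictness survives because some hyperplane contains a member. *)
Lemma up_avg E S k : (k.+1 < \dim E)%N -> S \subset btw 0 E k -> S != set0 ->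
  (forall H, H \in btw 0 E (\dim E).-1 -> restr S H != set0 ->
     #|restr S H|%:R * (Q ^+ (\dim E - k.+1) - 1)
       < #|up H (restr S H) k.+1|%:R * (Q ^+ k - 1)) ->
  #|S|%:R * (Q ^+ (\dim E - k) - 1) < #|up E S k.+1|%:R * (Q ^+ k - 1).
Proof.
move=> ltkE sS S0 IH.
have Q1 : 0 < Q - 1 by rewrite -[Q]expr1 expqB1_gt0 ?q1.
have Qe : 0 < Q ^+ (\dim E - k.+1) - 1 by rewrite expqB1_gt0 ?q1 ?subn_gt0.
have : \sum_(H in btw 0 E (\dim E).-1)
          #|restr S H|%:R * (Q ^+ (\dim E - k.+1) - 1)
   < \sum_(H in btw 0 E (\dim E).-1)
          #|up H (restr S H) k.+1|%:R * (Q ^+ k - 1).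
  have [A AS] := set0Pn _ S0.
  have /and3P[_ sAE /eqP dA] : [&& (0 <= A)%VS, (A <= E)%VS & \dim A == k].
    by rewrite -in_btw; apply: (subsetP sS).
  have [|H0 [sAH sHE dH]] := btw_ex (k := (\dim E).-1) sAE; first by nlia.
  have H0E : H0 \in btw 0 E (\dim E).-1 by rewrite in_btw sub0v sHE dH eqxx.
  rewrite (bigD1 H0) //= [ltRHS](bigD1 H0) //=; apply: ltr_leD.
    by apply: IH => //; apply/set0Pn; exists A; rewrite inE AS.
  apply: ler_sum => H /andP[HE _].
  have [->|/(IH _ HE)/ltW//] := eqVneq (restr S H) set0.
  by rewrite cards0 mul0r mulr_ge0 ?ler0n ?expqB1_ge0 ?q1.
rewrite -!mulr_suml (sum_restr (ltnW ltkE) sS).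
move=> lt1.
have := sum_up S ltkE; move/(ler_wpM2r (expqB1_ge0 q1 k)).
move/(lt_le_trans lt1) => {lt1}.
rewrite -(ltr_pM2r Q1) => lt1.
have e1 := gauss1 q1 (\dim E - k); have e2 := gauss1 q1 (\dim E - k.+1).
rewrite -(ltr_pM2r Qe) -[X in _ * X * _ < _]e1.
have -> : #|up E S k.+1|%:R * (Q ^+ k - 1) * (Q ^+ (\dim E - k.+1) - 1) =
  #|up E S k.+1|%:R * G (\dim E - k.+1) 1 * (Q ^+ k - 1) * (Q - 1).
  by rewrite -e2; ring.
apply: le_lt_trans lt1; rewrite le_eqVlt; apply/orP; left; apply/eqP; ring.
Qed.

(* A vector space form of the Lovász version of the Kruskal-Katona theorem
   (for upper shadows): the second alternative is the range of families at
   least as large as a star. *)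
Lemma shadow_growth E S e k : \dim E = e.+1 -> (k < e)%N ->
  S \subset btw 0 E k.+1 -> S != set0 ->
  #|S|%:R * (Q ^+ (e - k) - 1) < #|up E S k.+2|%:R * (Q ^+ k.+1 - 1)
  \/ (G e k <= #|S|%:R /\ G e k.+1 <= #|up E S k.+2|%:R).
Proof.
elim: e E S => [//|e IH] E S dE ltke sS S0.
have Qk := expqB1_gt0 q1 (ltn0Sn k).
have Qe : 0 < Q ^+ (e.+1 - k) - 1 by rewrite expqB1_gt0 ?q1 //; nlia.
(* A shadow as large as a star settles the claim: either S has the size of a star too, or it is
   smaller and [gauss_ratio] gives the strict inequality. *)
have fin : G e.+1 k.+1 <= #|up E S k.+2|%:R ->
  #|S|%:R * (Q ^+ (e.+1 - k) - 1) < #|up E S k.+2|%:R * (Q ^+ k.+1 - 1)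
  \/ (G e.+1 k <= #|S|%:R /\ G e.+1 k.+1 <= #|up E S k.+2|%:R).
  move=> upge; have [geS|ltS] := lerP (G e.+1 k) #|S|%:R; [by right|left].
  apply: (@lt_le_trans _ _ (G e.+1 k * (Q ^+ (e.+1 - k) - 1))).
    by rewrite ltr_pM2r.
  by rewrite -gauss_ratio ?q1 ?ler_pM2r //; nlia.
have [eqk|ltke'] := leqP e k.
  apply: fin; have -> : e = k by nlia.
  rewrite gaussnn ?q1 // (ler_nat _ 1) card_gt0; apply/set0Pn; exists E.
  have [A AS] := set0Pn _ S0.
  apply/upP; split; rewrite ?subvv //; first by nlia.
  by exists A => //; have := subsetP sS _ AS; rewrite in_btw => /and3P[].
(* Either one hyperplane carries as many members as a star in it, and Pascal's rule lifts its large
   shadow to E, or every nonempty trace falls under the strict alternative and averaging applies. *)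
have [/existsP[H /andP[HE geH]]|nH] := boolP [exists H,
    (H \in btw 0 E (\dim E).-1) && (G e k <= #|restr S H|%:R)].
  move: HE; rewrite in_btw dE /= => /and3P[_ sHE /eqP dH].
  have H0 : restr S H != set0.
    rewrite -card_gt0 -(ltr_nat rat); apply: lt_le_trans geH.
    by rewrite gauss_gt0 ?q1 // ltnW.
  have upH : G e k.+1 <= #|up H (restr S H) k.+2|%:R.
    case: (IH _ _ dH ltke' (restr_btw sHE sS) H0) => [ltH|[] //].
    rewrite -(ler_pM2r Qk) (gauss_ratio q1 (ltnW ltke')).
    by apply: le_trans (ltW ltH); rewrite ler_wpM2r ?expqB1_ge0 ?q1.
  apply: fin; have := up_split sHE (etrans dE (congr1 succn (esym dH))) _ sS.
  rewrite dH => /(_ (ltnW ltke')); apply: le_trans.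
  rewrite (gauss_pascalr q1 (ltnW ltke')) lerD // subSS.
  by rewrite ler_wpM2l ?exprn_ge0.
left; rewrite -subSS -dE; apply: up_avg => //; first by nlia.
move=> H HE H0; rewrite dE subSS.
have ltH : #|restr S H|%:R < G e k.
  by rewrite ltNge; apply: contra nH => geH; apply/existsP; exists H; rewrite HE.
move: HE; rewrite in_btw dE /= => /and3P[_ sHE /eqP dH].
case: (IH _ _ dH ltke' (restr_btw sHE sS) H0) => [|[]]; first by rewrite subSS.
by rewrite leNgt ltH.
Qed.

End UpperShadow.

(** * Stars as the equality case of the shadow bound *)

Section ShadowStar.
Variables (F : finFieldType) (n : nat).
Local Notation V := 'rV[F]_n.
Local Notation q := #|F|.
Local Notation G := (gauss_binom q).
Local Notation Q := (q%:R : rat).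
Local Notation q1 := (card_field_gt1 F).
Implicit Types (A B U W X E H J K : {vspace V}) (S T : {set {vspace V}}).

Lemma eq_sub_dim U W : (U <= W)%VS -> (\dim W <= \dim U)%N -> U = W.
Proof. by move=> sUW dUW; apply/eqP; rewrite eqEdim sUW. Qed.

Lemma notin_vspace_ex U W : (\dim U < \dim W)%N ->
  exists2 v, v \in W & v \notin U.
Proof.
by move=> ltd; apply/subvPn; apply: contraL ltd => /dimvS; rewrite -leqNgt.
Qed.

Lemma point_ex U : (0 < \dim U)%N -> exists2 X, (X <= U)%VS & \dim X = 1%N.
Proof.
move=> dU; have [|X [_ sXU dX]] := btw_ex (k := 1) (sub0v U).
  by rewrite dimv0.
by exists X.
Qed.

(** If A missed X, then A + <v> with v outside A + X would be in the shadow, hence contain X and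
    equal A + X, against the choice of v. Such a v exists because k + 1 < dim E. *)
Lemma up_star_restr E S k X : \dim X = 1%N -> (k.+1 < \dim E)%N ->
  S \subset btw 0 E k -> (forall W, W \in up E S k.+1 -> (X <= W)%VS) ->
  forall A, A \in S -> (X <= A)%VS.
Proof.
move=> dX ltkE sS allW A AS; apply/idPn => nXA.
have := subsetP sS _ AS; rewrite in_btw => /and3P[_ sAE /eqP dA].
have dAX : \dim (A + X) = k.+1.
  have := dimv_sum_cap A X; suff -> : \dim (A :&: X) = 0%N by rewrite dA dX; nlia.
  have : \dim (A :&: X) != \dim X.
    apply: contra nXA => /eqP eqd; rewrite -(eq_sub_dim (capvSr A X)) ?capvSl //.
    by rewrite eqd.
  by have := dimvS (capvSr A X); rewrite dX; nlia.
have [v vE vAX] : exists2 v, v \in E & v \notin (A + X)%VS.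
  by apply: notin_vspace_ex; rewrite dAX.
have vA : v \notin A by apply: contra vAX; apply: (subvP (addvSl _ _)).
have dAv := dim_add_line vA.
have sXW : (X <= A + <[v]>)%VS.
  apply: allW; apply/upP; split; rewrite ?subv_add ?sAE -?memvE ?dAv ?dA //.
  by exists A; rewrite ?addvSl.
have eqW : (A + X = A + <[v]>)%VS.
  by apply: eq_sub_dim; rewrite ?subv_add ?addvSl ?sXW // dAv dAX dA.
by move: vAX; rewrite eqW (subvP (addvSr _ _)) ?memv_line.
Qed.

(* The hyperplanes in the shadow are closed under pencils, and the smallest
   subspace all of whose hyperplanes lie in the shadow is common to all. *)
Lemma shadow_star_base E S k : \dim E = k.+3 -> S \subset btw 0 E k.+1 ->
  G k.+2 k <= #|S|%:R -> #|up E S k.+2|%:R <= G k.+2 k.+1 ->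
  exists2 X, \dim X = 1%N & forall A, A \in S -> (X <= A)%VS.
Proof.
move=> dE sS geS leSh; set Sh := up E S k.+2 in leSh.
have Q0 : 0 < Q by rewrite ltr0n ltnW ?q1.
have symk : G k.+2 k.+1 = G k.+2 1 by rewrite -gauss_sym ?q1 // subSS subSnn.
have ShE H : H \in Sh -> (H <= E)%VS /\ \dim H = k.+2 by case/upP.
have inSh K : (K <= E)%VS -> \dim K = k.+2 -> forall A, A \in S -> (A <= K)%VS -> K \in Sh.
  by move=> sKE dK A AS sAK; apply/upP; split=> //; exists A.
have S0 : S != set0.
  by rewrite -card_gt0 -(ltr_nat rat); apply: lt_le_trans geS; rewrite gauss_gt0 ?q1 //; nlia.
(* The summand 1 is H itself, which lies in its own part of the shadow. *)
have outle H : H \in Sh ->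
    1 + Q * #|restr S H|%:R <= #|Sh|%:R
  /\ #|upout E H S k.+2|%:R = Q * #|restr S H|%:R.
  move=> HSh; have [sHE dH] := ShE _ HSh.
  have dEH : \dim E = (\dim H).+1 by rewrite dE dH.
  have lekH : (k.+1 <= \dim H)%N by rewrite dH.
  have eQ : Q ^+ (\dim H - k.+1) = Q by rewrite dH subSS subSnn.
  have := up_split sHE dEH lekH sS; have := card_upout sHE dEH lekH sS.
  rewrite eQ => -> le1; split=> //; apply: le_trans le1; rewrite lerD2r.
  rewrite (ler_nat _ 1) card_gt0; apply/set0Pn; exists H.
  case/upP: HSh => _ _ [A AS sAH]; apply/upP; split; rewrite ?subvv //.
  by exists A; rewrite // inE AS.
have restrle H : H \in Sh -> #|restr S H|%:R <= G k.+1 1.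
  case/outle => le1 _; have := le_trans le1 leSh.
  by rewrite symk gauss1S ?q1 // lerD2l ler_pM2l.
(* Each member lies in q + 1 hyperplanes of E, all in the shadow, and [k+2,2][2,1] = [k+2,1][k+1,1].
   So the traces on the hyperplanes of the shadow reach their maximum [k+1,1] on average, hence
   everywhere. *)
have sumSh : \sum_(H in Sh) (G k.+1 1 - #|restr S H|%:R) <= 0.
  rewrite sumrB big_const iter_addr addr0 subr_le0 -mulr_natl.
  apply: (@le_trans _ _ (G k.+2 k * G 2 1)).
    rewrite (_ : G k.+2 k * _ = G k.+2 1 * G k.+1 1).
      by rewrite ler_wpM2r ?gauss_ge0 ?q1 // -symk.
    have -> : G k.+2 k = G k.+2 2 
      by rewrite -(gauss_sym q1 (leqW (leqnSn k))); congr (G _ _); nlia.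
    have Q1 : Q - 1 != 0 by rewrite -[Q]expr1 expqB1_neq0 ?q1.
    apply: (mulIf Q1); rewrite -[LHS]mulrA gauss1 ?q1 //.
    by rewrite gaussSS ?q1 // -(gauss1 q1); ring.
  have := sum_restr _ sS; rewrite dE (_ : k.+3 - k.+1 = 2)%N /=; last nlia.
  move=> /(_ (leqnSn _)).
  move=> sumr; apply: (@le_trans _ _ (#|S|%:R * G 2 1)).
    by rewrite ler_wpM2r ?gauss_ge0 ?q1.
  rewrite -sumr (bigID (mem Sh)) /= [X in _ + X]big1 => [|H /andP[]].
    rewrite addr0 [leRHS]big_mkcond [leLHS]big_mkcond.
    by apply: ler_sum => H _; case: (H \in Sh); rewrite ?andbF //; case: ifP.
  rewrite in_btw => /and3P[_ sHE /eqP dH] nHSh.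
  rewrite (_ : restr S H = set0) ?cards0 //; apply/setP => A; rewrite !inE.
  by apply: contraNF nHSh => /andP[AS sAH]; apply: inSh sAH.
have restreq H : H \in Sh -> #|restr S H|%:R = G k.+1 1.
  move=> HSh; apply/eqP; rewrite eq_le restrle //= -subr_le0.
  apply: le_trans sumSh; rewrite (bigD1 H) //= lerDl sumr_ge0 // => H' /andP[H'Sh _].
  by rewrite subr_ge0 restrle.
(* Since the trace on H is maximal, [upout] exhausts the shadow except for H, so every other
   hyperplane of the shadow meets H in a member. *)
have meetS H H' : H \in Sh -> H' \in Sh -> H' != H -> (H' :&: H)%VS \in S.
  move=> HSh H'Sh neqH; have [le1 eqo] := outle _ HSh.
  have eqD : upout E H S k.+2 = Sh :\ H.
    apply/eqP; rewrite eqEcard; apply/andP; split.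
      apply/subsetP => W WD; apply/setD1P; split; last first.
        exact: (subsetP (upout_up _ _ _ _) _ WD).
      by move: WD; rewrite inE => /andP[_ /andP[+ _]]; apply: contraNneq => ->.
    have : #|Sh|%:R <= (#|upout E H S k.+2|.+1)%:R :> rat.
      rewrite -natr1 eqo restreq // addrC; apply: le_trans leSh _.
      by rewrite symk gauss1S ?q1.
    by rewrite ler_nat (cardsD1 H Sh) HSh.
  have : H' \in Sh :\ H by apply/setD1P.
  by rewrite -eqD inE => /andP[_ /andP[]].
pose P J := (J <= E)%VS && (btw J E k.+2 \subset Sh).
have [A0 A0S] := set0Pn _ S0.
have := subsetP sS _ A0S; rewrite in_btw => /and3P[_ sA0E /eqP dA0].
have [|H0 [sAH0 sH0E dH0]] := btw_ex (k := k.+2) sA0E; first by rewrite dA0 dE; nlia.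
have PH0 : P H0.
  rewrite /P sH0E; apply/subsetP => K; rewrite in_btw => /and3P[sHK _ /eqP dK].
  by rewrite -(eq_sub_dim sHK) ?dK ?dH0 //; apply: inSh sAH0.
case: (arg_minnP (fun J => \dim J) PH0) => J /andP[sJE /subsetP PJ] minJ.
(* For J = 0 all [k+3,1] hyperplanes would be in the shadow, more than twice the number allowed. *)
have dJ : (0 < \dim J)%N.
  rewrite lt0n dimv_eq0; apply/eqP => J0.
  have : #|btw J E k.+2|%:R <= #|Sh|%:R :> rat.
    by rewrite ler_nat subset_leq_card //; apply/subsetP.
  rewrite J0 card_btw ?sub0v ?dimv0 // !subn0 dE -gauss_sym ?q1 // subSnn.
  move/le_trans/(_ leSh); rewrite symk leNgt => /negP; apply.
  have := gauss1_double q1 k.+2; have := gauss_ge0 q1 k.+2 1; lra.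
have allJ H : H \in Sh -> (J <= H)%VS.
  move=> HSh; apply/idPn => nJH; have [sHE dH] := ShE _ HSh.
  have dEH : \dim E = (\dim H).+1 by rewrite dE dH.
  have dJH := dim_cap_hyper sHE dEH sJE nJH.
  suff /minJ : P (J :&: H)%VS by rewrite dJH ltnn.
  rewrite /P (subv_trans (capvSl _ _) sJE); apply/subsetP => K.
  rewrite in_btw => /and3P[sJHK sKE /eqP dK].
  have [sJK|nJK] := boolP (J <= K)%VS; first by apply: PJ; rewrite in_btw sJK sKE dK /=.
  have [-> //|neqKH] := eqVneq K H.
  have nKH : ~~ (K <= H)%VS.
    by apply: contra neqKH => /eq_sub_dim ->; rewrite // dK dH.
  have dKH := dim_cap_hyper sHE dEH sKE nKH.
  (* K' is the hyperplane through J in the pencil of K and H: it meets H exactly in [K :&: H], which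
     is therefore a member, and K contains it. *)
  pose K' := (J + K :&: H)%VS.
  have sK'E : (K' <= E)%VS by rewrite subv_add sJE (subv_trans (capvSl _ _)).
  have dK' : \dim K' = k.+2.
    have := dimv_sum_cap J (K :&: H); rewrite -/K'.
    have -> : (J :&: (K :&: H) = J :&: H)%VS.
      apply/vspaceP => x; rewrite !memv_cap; apply/and3P/andP => [[-> _ ->] //|[xJ xH]].
      by split=> //; apply: (subvP sJHK); rewrite memv_cap xJ.
    by move: dKH; rewrite dJH dK; clear; lia.
  have K'Sh : K' \in Sh by apply: PJ; rewrite in_btw addvSl sK'E dK' /=.
  have nK'H : ~~ (K' <= H)%VS.
    by apply: contra nJH; apply: subv_trans; apply: addvSl.
  have dK'H := dim_cap_hyper sHE dEH sK'E nK'H.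
  apply: (inSh _ sKE dK (K' :&: H)%VS).
    by apply: meetS => //; apply: contraNneq nK'H => ->; rewrite subvv.
  rewrite -(eq_sub_dim (_ : K :&: H <= K' :&: H)%VS) ?capvSl //.
    by rewrite subv_cap addvSr capvSr.
  by move: dKH dK'H; rewrite dK dK' => -[->] [->].
have [X sXJ dX] := point_ex dJ; exists X => //.
apply: (up_star_restr (E := E) (k := k.+1)) => //; first by rewrite dE.
by move=> W WSh; apply: subv_trans sXJ (allJ _ WSh).
Qed.

(** Some hyperplane H carries as many members as a star, since otherwise averaging makes the shadow
    too large; by [up_split] the shadow inside H is then no larger than a star, and by induction the
    members in H form a full star at X. Every (k+2)-space W of E through X contains a member inside
    [W :&: H], so the shadow in E is the full star at X, and [up_star_restr] descends to S. *)
Lemma shadow_star E S e k : \dim E = e.+2 -> (k < e)%N ->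
  S \subset btw 0 E k.+1 ->
  G e.+1 k <= #|S|%:R -> #|up E S k.+2|%:R <= G e.+1 k.+1 ->
  exists2 X, \dim X = 1%N & forall A, A \in S -> (X <= A)%VS.
Proof.
elim: e E S => [//|e IH] E S dE ltke sS geS leSh.
have [eqk|ltke'] := leqP e k.
  have ek : e = k by nlia.
  by rewrite ek in dE geS leSh; apply: shadow_star_base geS leSh.
have S0 : S != set0.
  rewrite -card_gt0 -(ltr_nat rat); apply: lt_le_trans geS.
  by rewrite gauss_gt0 ?q1 //; nlia.
have [/existsP[H /andP[HE geH]]|nH] := boolP [exists H,
    (H \in btw 0 E (\dim E).-1) && (G e.+1 k <= #|restr S H|%:R)]; last first.
  suff : #|S|%:R * (Q ^+ (\dim E - k.+1) - 1) < #|up E S k.+2|%:R * (Q ^+ k.+1 - 1).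
    have le1 : #|up E S k.+2|%:R * (Q ^+ k.+1 - 1) <= G e.+2 k.+1 * (Q ^+ k.+1 - 1).
      by rewrite ler_wpM2r ?expqB1_ge0 ?q1.
    move/lt_le_trans/(_ le1); rewrite gauss_ratio ?q1 //; last by nlia.
    by rewrite dE subSS ltNge ler_wpM2r ?expqB1_ge0 ?q1.
  apply: up_avg => //; first by nlia.
  move=> H HE H0.
  have ltH : #|restr S H|%:R < G e.+1 k.
    by rewrite ltNge; apply: contra nH => geH; apply/existsP; exists H; rewrite HE.
  move: HE; rewrite in_btw dE /= => /and3P[_ sHE /eqP dH].
  case: (shadow_growth dH _ (restr_btw sHE sS) H0) => [||[]]; first by nlia.
    by rewrite !subSS.
  by rewrite leNgt ltH.
move: HE; rewrite in_btw dE /= => /and3P[_ sHE /eqP dH].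
have := up_split sHE (etrans dE (congr1 succn (esym dH))) _ sS.
rewrite dH subSS => /(_ (leqW (ltnW ltke'))) /le_trans/(_ leSh).
rewrite (gauss_pascalr q1 (leqW (ltnW ltke'))) => le1.
have upH : #|up H (restr S H) k.+2|%:R <= G e.+1 k.+1.
  have : Q ^+ (e.+1 - k) * G e.+1 k <= Q ^+ (e.+1 - k) * #|restr S H|%:R.
    by rewrite ler_wpM2l ?exprn_ge0.
  by move: le1; set a := Q ^+ _ * _; set b := Q ^+ _ * _; lra.
have [X dX allX] := IH _ _ dH ltke' (restr_btw sHE sS) geH upH.
exists X => //.
have [A1] : exists A, A \in restr S H.
  apply/set0Pn; rewrite -card_gt0 -(ltr_nat rat); apply: lt_le_trans geH.
  by rewrite gauss_gt0 ?q1 //; nlia.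
move=> A1S; have sXH : (X <= H)%VS.
  by apply: subv_trans (allX _ A1S) _; move: A1S; rewrite inE => /andP[].
have eqrestr : restr S H = btw X H k.+1.
  apply/eqP; rewrite eqEcard -(ler_nat rat) card_btw ?dX // dH !subn1 geH andbT.
  apply/subsetP => A AS; rewrite in_btw allX //.
  by have := subsetP (restr_btw sHE sS) _ AS; rewrite in_btw => /and3P[_ -> ->].
have eqSh : up E S k.+2 = btw X E k.+2.
  apply/esym/eqP; rewrite eqEcard -(ler_nat rat) card_btw ?dX ?(subv_trans sXH) //.
  rewrite dE !subn1 leSh andbT; apply/subsetP => W.
  rewrite in_btw => /and3P[sXW sWE /eqP dW].
  have [A [sXA sAWH dA]] : exists A, [/\ (X <= A)%VS, (A <= W :&: H)%VS & \dim A = k.+1].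
    apply: btw_ex; first by rewrite subv_cap sXW.
    rewrite dX /=; have [sWH|nWH] := boolP (W <= H)%VS.
      by rewrite (capv_idPl sWH) dW.
    have := dim_cap_hyper sHE (etrans dE (congr1 succn (esym dH))) sWE nWH.
    by rewrite dW => -[->].
  move: sAWH; rewrite subv_cap => /andP[sAW sAH].
  have : A \in restr S H by rewrite eqrestr in_btw sXA sAH dA /=.
  by rewrite inE => /andP[AS _]; apply/upP; split=> //; exists A.
apply: (up_star_restr (E := E) (k := k.+1)) => //; first by nlia.
by move=> W; rewrite eqSh in_btw => /and3P[].
Qed.

End ShadowStar.

(** * Averaging over the general linear group *)

Section Averaging.
Variables (F : finFieldType) (n : nat).
Local Notation V := 'rV[F]_n.
Local Notation q := #|F|.
Local Notation G := (gauss_binom q).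
Local Notation q1 := (card_field_gt1 F).
Implicit Types (A B U W X E H : {vspace V}) (S T : {set {vspace V}}) (M N : 'M[F]_n).

Definition mxact M A : {vspace V} := (linfun (mulmxr M : V -> V) @: A)%VS.

Lemma mxact_ker M : M \in unitmx -> lker (linfun (mulmxr M : V -> V)) == 0%VS.
Proof.
by move=> uM; apply/lker0P => u v; rewrite !lfunE /= => /(can_inj (mulmxK uM)).
Qed.

Lemma dim_mxact M A : M \in unitmx -> \dim (mxact M A) = \dim A.
Proof. by move=> uM; rewrite limg_dim_eq // (eqP (mxact_ker uM)) capv0. Qed.

Lemma mxact_cap M A B : M \in unitmx ->
  mxact M (A :&: B) = (mxact M A :&: mxact M B)%VS.
Proof. by move=> uM; rewrite /mxact lker0_img_cap // mxact_ker. Qed.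

Lemma mxact_mul M N A : mxact (M *m N) A = mxact N (mxact M A).
Proof.
rewrite /mxact -limg_comp; congr (_ @: _)%VS.
by apply/lfunP => v; rewrite comp_lfunE !lfunE /= mulmxA.
Qed.

Lemma mxact1 A : mxact 1%:M A = A.
Proof.
rewrite /mxact (_ : linfun _ = \1%VF) ?lim1g //.
by apply/lfunP => v; rewrite !lfunE /= mulmx1.
Qed.

Lemma mxactK M A : M \in unitmx -> mxact (invmx M) (mxact M A) = A.
Proof. by move=> uM; rewrite -mxact_mul mulmxV // mxact1. Qed.

Let coord_space k : {vspace V} :=
  <<mkseq (fun i => \row_(j < n) (i == j)%:R) k>>%VS.

(** The rows of M are a basis of U followed by a basis of a complement. *)
Let coord_space_trans U :
  exists2 M, M \in unitmx & mxact M (coord_space (\dim U)) = U.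
Proof.
pose X := vbasis U ++ vbasis U^C.
have szX : size X = n.
  by rewrite size_cat !size_tuple dimv_compl dim_rV subnKC // dim_le.
have bX : basis_of fullv X.
  rewrite -(addv_complf U) cat_basis ?vbasisP // directvEgeq /=.
  by rewrite addv_complf dim_rV dimv_compl dim_rV subnKC ?dim_le.
pose M : 'M[F]_n := \matrix_(i < n) nth 0 X i.
have XM (x : V) : x *m M = \sum_(i < n) x 0 i *: nth 0 X i.
  by rewrite mulmx_sum_row; apply: eq_bigr => i _; rewrite rowK.
exists M.
  rewrite -row_free_unit; apply: inj_row_free => x; rewrite XM => x0.
  have /freeP fX : free (in_tuple X) by apply: basis_free bX.
  apply/rowP => i; rewrite mxE.
  have szi : (i < size X)%N by rewrite szX.
  rewrite -(fX (fun j => x 0 (cast_ord szX j)) _ (Ordinal szi)) //; last first.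
    rewrite (reindex (cast_ord (esym szX))) /=; last first.
      by exists (cast_ord szX) => j _; rewrite ?cast_ordK ?cast_ordKV.
    by rewrite -[RHS]x0; apply: eq_bigr => j _; rewrite cast_ordKV.
  by congr (x 0 _); apply: val_inj.
have eqU : tval (vbasis U) = mkseq (nth 0 X) (\dim U).
  apply: (@eq_from_nth _ 0) => [|i]; rewrite size_tuple ?size_mkseq // => lti.
  by rewrite nth_mkseq // nth_cat size_tuple lti.
rewrite /mxact limg_span -[RHS](span_basis (vbasisP U)) eqU; congr <<_>>%VS.
apply: (@eq_from_nth _ 0) => [|i]; rewrite size_map ?size_mkseq // => lti.
rewrite (nth_map 0) ?size_mkseq // !nth_mkseq //.
have ltin : (i < n)%N := leq_trans lti (dim_le U).
rewrite lfunE /= XM (bigD1 (Ordinal ltin)) //= mxE eqxx scale1r big1 ?addr0 // => j.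
rewrite mxE eq_sym => /negPf neqj.
by rewrite (_ : (i == j) = false) ?scale0r //; apply: contraFF neqj => /eqP eqij; apply/eqP/val_inj.
Qed.

Lemma mxact_trans U W : \dim U = \dim W ->
  exists2 M, M \in unitmx & mxact M U = W.
Proof.
move=> eqd; have [M uM eqM] := coord_space_trans U.
have [N uN eqN] := coord_space_trans W; exists (invmx M *m N).
  by rewrite unitmx_mul unitmx_inv uM.
by rewrite mxact_mul -{1}eqM mxactK // eqd.
Qed.

Let GLn := [set M : 'M[F]_n | M \in unitmx].

Let card_GLn_gt0 : (0 < #|GLn|)%N.
Proof. by apply/card_gt0P; exists 1%:M; rewrite inE unitmx1. Qed.

Let movers U W := [set M in GLn | mxact M U == W].

Let card_movers_eq U W W' : \dim W = \dim W' -> (#|movers U W| <= #|movers U W'|)%N.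
Proof.
case/mxact_trans => N uN <-.
rewrite -(card_imset (mem (movers U W)) (can_inj (mulmxK uN))).
apply/subset_leq_card/subsetP => _ /imsetP[M MW ->].
move: MW; rewrite !inE => /andP[uM /eqP <-].
by rewrite unitmx_mul uM uN mxact_mul eqxx.
Qed.

Let card_movers U W : \dim U = \dim W ->
  #|movers U W|%:R * G n (\dim U) = #|GLn|%:R.
Proof.
move=> eqd; have := double_count (fun M W' => mxact M U == W') GLn (subspaces F n (\dim U)).
rewrite (eq_bigr (fun=> 1%N)); last first.
  move=> M; rewrite inE => uM; rewrite (_ : [set _ in _ | _] = [set mxact M U]) ?cards1 //.
  apply/setP => A; rewrite !inE eq_sym; have [->|] := eqVneq A; last by rewrite andbF.
  by rewrite dim_mxact // eqxx.
rewrite sum1_card (eq_bigr (fun=> #|movers U W|)); last first.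
  move=> A; rewrite inE => /eqP dA; apply/eqP.
  by rewrite eqn_leq !card_movers_eq // dA.
move/(congr1 (fun m : nat => m%:R : rat)) => ->.
by rewrite big_const iter_addn addn0 natrM card_subspaces.
Qed.

(** Double count of the pairs (M, i) with the image of [s i] in [T i]. By transitivity all spaces of
    the right dimension are images of [s i] under equally many matrices, so i accounts for the
    fraction |T i|/[n, dim (s i)] of the group; by the second hypothesis no M is counted twice. *)
Lemma clique_average (I : finType) (s : I -> {vspace V})
    (T : I -> {set {vspace V}}) :
  (forall i, T i \subset subspaces F n (\dim (s i))) ->
  (forall M i j, M \in unitmx ->
     mxact M (s i) \in T i -> mxact M (s j) \in T j -> i = j) ->
  (\sum_i #|T i|%:R / G n (\dim (s i))) * #|GLn|%:R
    = #|[set M in GLn | [exists i, mxact M (s i) \in T i]]|%:R.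
Proof.
move=> sT uniqT.
have -> : #|[set M in GLn | [exists i, mxact M (s i) \in T i]]|
  = (\sum_(i in setT) #|[set M in GLn | mxact M (s i) \in T i]|)%N.
  rewrite (double_count (fun i M => mxact M (s i) \in T i) setT GLn).
  rewrite (bigID (fun M => [exists i, mxact M (s i) \in T i])) /=.
  rewrite [X in (_ + X)%N]big1 ?addn0 => [|M /andP[_ /existsPn nT]]; last first.
    by apply/eqP; rewrite cards_eq0; apply/eqP/setP => i; rewrite !inE (negPf (nT i)).
  rewrite (eq_bigr (fun=> 1%N)) => [|M /andP[]]; last first.
    rewrite inE => uM /existsP[i iT]; rewrite (_ : [set _ in _ | _] = [set i]) ?cards1 //.
    apply/setP => j; rewrite !inE /=; apply/idP/eqP => [jT|-> //].
    exact: (uniqT M).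
  by rewrite sum1dep_card; apply: eq_card => M; rewrite !inE.
rewrite natr_sum mulr_suml; apply: eq_big => [i|i _]; first by rewrite inE.
have := double_count (fun A M => mxact M (s i) == A) (T i) GLn.
rewrite [X in _ = X -> _](eq_bigr (fun M => mxact M (s i) \in T i : nat)); last first.
  move=> M _; have [iT|iT] := boolP (_ \in _).
    rewrite (_ : [set _ in _ | _] = [set mxact M (s i)]) ?cards1 //.
    by apply/setP => A; rewrite !inE eq_sym; have [->|] := eqVneq A; rewrite ?andbF ?iT.
  apply/eqP; rewrite cards_eq0; apply/eqP/setP => A; rewrite !inE.
  by apply: contraNF iT => /andP[AT /eqP ->].
have -> : (\sum_(M in GLn) (mxact M (s i) \in T i : nat)
   = #|[set M in GLn | mxact M (s i) \in T i]|)%N.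
  rewrite -sum1dep_card big_mkcondr /=; apply: eq_bigr => M _.
  by case: (_ \in T i).
move/(congr1 (fun m : nat => m%:R : rat)) <-; rewrite natr_sum.
have [T0|[A0 A0T]] := set_0Vmem (T i).
  by rewrite T0 big_set0 cards0 !mul0r.
have dT A : A \in T i -> \dim (s i) = \dim A.
  by move/(subsetP (sT i)); rewrite inE => /eqP.
have G0 : G n (\dim (s i)) != 0 by rewrite gt_eqF // gauss_gt0 ?q1 ?dim_le.
rewrite (eq_bigr (fun=> #|GLn|%:R / G n (\dim (s i)))); last first.
  by move=> A /dT/card_movers <-; rewrite mulfK.
rewrite big_const iter_addr addr0 -mulr_natl; ring.
Qed.

Lemma clique_bound (I : finType) (s : I -> {vspace V})
    (T : I -> {set {vspace V}}) :
  (forall i, T i \subset subspaces F n (\dim (s i))) ->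
  (forall M i j, M \in unitmx ->
     mxact M (s i) \in T i -> mxact M (s j) \in T j -> i = j) ->
  \sum_i #|T i|%:R / G n (\dim (s i)) <= 1.
Proof.
move=> sT uniqT; have := clique_average sT uniqT => eqa.
have GL0 : 0 < #|GLn|%:R :> rat by rewrite ltr0n.
rewrite -(ler_pM2r GL0) eqa mul1r ler_nat subset_leq_card //.
by apply/subsetP => M; rewrite inE => /andP[].
Qed.

(** When the fractions add up to 1, every invertible matrix moves some [s i] into [T i], in
    particular the identity. *)
Lemma clique_tight (I : finType) (s : I -> {vspace V})
    (T : I -> {set {vspace V}}) :
  (forall i, T i \subset subspaces F n (\dim (s i))) ->
  (forall M i j, M \in unitmx ->
     mxact M (s i) \in T i -> mxact M (s j) \in T j -> i = j) ->
  1 <= \sum_i #|T i|%:R / G n (\dim (s i)) ->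
  exists i, s i \in T i.
Proof.
move=> sT uniqT; have := clique_average sT uniqT => eqa.
have GL0 : 0 < #|GLn|%:R :> rat by rewrite ltr0n.
rewrite -(ler_pM2r GL0) eqa mul1r ler_nat => le1.
have /eqP eqGL : [set M in GLn | [exists i, mxact M (s i) \in T i]] == GLn.
  by rewrite eqEcard le1 andbT; apply/subsetP => M; rewrite inE => /andP[].
have : 1%:M \in GLn by rewrite inE unitmx1.
by rewrite -eqGL inE => /andP[_ /existsP[i]]; rewrite mxact1; exists i.
Qed.

End Averaging.

(** * Gabidulin codes *)

Section Gabidulin.
Variable F : finFieldType.
Local Notation q := #|F|.
Local Notation q1 := (card_field_gt1 F).

Lemma card_prime_power : exists2 p, p \in [pchar F] & exists e, q = (p ^ e)%N.
Proof.
have [p p_pr pF] := finPcharP F; exists p => //.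
by exists (logn p q); exact: (card_pprimeChar pF).
Qed.

Lemma expDq (L : fieldExtType F) (x y : L) i :
  (x + y) ^+ (q ^ i) = x ^+ (q ^ i) + y ^+ (q ^ i).
Proof.
have [p pF [e ->]] := card_prime_power.
have pL : p \in [pchar L] by rewrite pchar_lalg.
rewrite exprDn_pchar // -expnM pnatX; apply/orP; left.
by rewrite pnatE ?(pcharf_prime pL).
Qed.

Lemma expZq (L : fieldExtType F) (a : F) (x : L) i :
  (a *: x) ^+ (q ^ i) = a *: x ^+ (q ^ i).
Proof.
rewrite exprZn; congr (_ *: _); elim: i => [|i IH]; first by rewrite expr1.
by rewrite expnSr exprM IH expf_card.
Qed.

Lemma exp0q (L : fieldExtType F) i : (0 : L) ^+ (q ^ i) = 0.
Proof. by rewrite expr0n expn_eq0 -[q == 0%N]leqn0 leqNgt ltnW ?q1. Qed.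

Lemma exp_lincomb (L : fieldExtType F) (I : finType) (c : I -> F) (x : I -> L) i :
  (\sum_j c j *: x j) ^+ (q ^ i) = \sum_j c j *: x j ^+ (q ^ i).
Proof.
elim/big_rec2: _ => [|j y z _ <-]; first exact: exp0q.
by rewrite expDq expZq.
Qed.

(* The roots of [X^(q^m) - X] in a splitting field: a copy of the field with
   [q^m] elements. *)
Lemma subfield_ex m : (0 < m)%N ->
  exists (L : fieldExtType F) (K : {vspace L}), \dim K = m
    /\ forall x, (x \in K) = (x ^+ (q ^ m) == x).
Proof.
move=> m0; pose p : {poly F} := 'X^(q ^ m) - 'X.
have qm1 : (1 < q ^ m)%N by rewrite -(exp1n m) ltn_exp2r ?q1.
have szp (R : nzRingType) : size ('X^(q ^ m) - 'X : {poly R}) = (q ^ m).+1.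
  by rewrite size_polyDl size_polyXn // size_polyN size_polyX.
have p0 : p != 0 by rewrite -size_poly_gt0 szp.
have [L [zs eqp _]] := FinSplittingFieldFor p0.
rewrite rmorphB rmorphXn /= map_polyX in eqp.
(* The derivative is -1 because q^m vanishes in L, so the roots are distinct. *)
have uzs : uniq zs.
  rewrite -separable_prod_XsubC -(eqp_separable eqp) unlock /separable_poly.
  rewrite derivB derivXn derivX.
  have -> : 'X^((q ^ m).-1) *+ (q ^ m) = 0 :> {poly L}.
    have [p' pF [e eqe]] := card_prime_power.
    have pL : p' \in [pchar L] by rewrite pchar_lalg.
    suff q0 : (q ^ m)%:R = 0 :> L by rewrite -mulr_natr -polyC_natr q0 mulr0.
    apply/eqP; rewrite -(dvdn_pcharf pL) eqe -expnM.
    apply: dvdn_exp (dvdnn _); rewrite muln_gt0 m0 andbT lt0n.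
    by apply: contraTneq q1 => e0; rewrite eqe e0.
  by apply/Bezout_eq1_coprimepP; exists (0, -1); rewrite /= mul0r add0r mulN1r sub0r opprK.
have in_zs x : (x \in zs) = (x ^+ (q ^ m) == x).
  by rewrite -root_prod_XsubC -(eqp_root eqp) /root !hornerE subr_eq0.
have szzs : size zs = (q ^ m)%N.
  by apply: succn_inj; rewrite -(size_prod_XsubC _ id) -(eqp_size eqp) szp.
(* The q^m-th power map is F-linear, so the roots already form an F-subspace and the span adds
   nothing. *)
pose K : {vspace L} := <<zs>>%VS.
have inK x : (x \in K) = (x ^+ (q ^ m) == x).
  apply/idP/idP => [xK|]; last by rewrite -in_zs => /memv_span.
  rewrite (coord_span (X := in_tuple zs) xK) exp_lincomb; apply/eqP/eq_bigr => i _.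
  by congr (_ *: _); apply/eqP; rewrite -in_zs mem_nth.
exists L, K; split=> //.
pose K' : {vspace finvect_type L} := K.
have : #|K'| = (q ^ m)%N.
  pose zs' : seq (finvect_type L) := zs; have uzs' : uniq zs' := uzs.
  rewrite -szzs -[size zs]/(size zs') -(card_uniqP uzs'); apply: eq_card => x.
  by have := in_zs x; rewrite -inK.
by rewrite card_vspace => /eqP; rewrite eqn_exp2l ?q1 // => /eqP.
Qed.

(** The code word of a is the q-polynomial with coefficients a_0, ..., a_(r-1), evaluated at the
    first k vectors of an F-basis of the field with q^m elements. A combination x of these vectors
    killed by the difference of two code words is a root of a nonzero polynomial of degree at most
    q^(r-1). *)
Lemma gabidulin k m r : (k <= m)%N -> (0 < m)%N ->
  exists C : {ffun 'I_r -> 'rV[F]_m} -> 'M[F]_(k, m),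
    forall a b, a != b ->
      (#|[set x : 'rV[F]_k | (x *m (C a - C b) == 0)%R]| <= q ^ r.-1)%N.
Proof.
move=> lekm /subfield_ex[L [K [dK inK]]].
move: lekm inK; rewrite -{m}dK => lekm inK.
have KM x y : x \in K -> y \in K -> x * y \in K.
  by rewrite !inK exprMn => /eqP-> /eqP->.
have KX x i : x \in K -> x ^+ i \in K.
  by rewrite !inK -exprM mulnC exprM => /eqP->.
pose X := vbasis K; pose e (j : 'I_(\dim K)) : L := X`_j.
have eK j : e j \in K by rewrite vbasis_mem // mem_nth ?size_tuple.
pose vec (c : 'rV[F]_(\dim K)) : L := \sum_j c 0 j *: e j.
have vecK c : vec c \in K by apply: memv_suml => j _; rewrite memvZ.
have vec_inj : injective vec.
  move=> c c' eqc; apply/rowP => j.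
  have fX : free X by apply: basis_free (vbasisP K).
  have coordE (d : 'rV[F]_(\dim K)) : coord X j (vec d) = d 0 j by rewrite coord_sum_free.
  by rewrite -!coordE eqc.
pose wid := widen_ord lekm.
pose emb (x : 'rV[F]_k) : L := \sum_i x 0 i *: e (wid i).
have emb_inj : injective emb.
  move=> x y; pose ext (z : 'rV[F]_k) : 'rV[F]_(\dim K) := \row_j
    (if insub (j : nat) is Some i then z 0 (i : 'I_k) else 0).
  have embE z : emb z = vec (ext z).
    rewrite /emb /vec (bigID (fun j : 'I_(\dim K) => j < k)%N) /=.
    rewrite [X in _ + X]big1 ?addr0 => [|j /negPf ltj]; last first.
      by rewrite mxE insubF ?scale0r.
    rewrite (big_ord_narrow lekm); apply: eq_bigr => i _.
    by rewrite mxE /= insubT //= => ltik; congr (z 0 _ *: _); apply: val_inj.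
  rewrite !embE => /vec_inj/rowP eqxy; apply/rowP => i.
  have := eqxy (wid i); rewrite !mxE /= insubT //= => ltik.
  by rewrite (_ : Sub _ _ = i) //; apply: val_inj.
pose phi (a : {ffun 'I_r -> 'rV[F]_(\dim K)}) (x : L) := \sum_(i < r) vec (a i) * x ^+ (q ^ i).
have phiK a x : x \in K -> phi a x \in K.
  by move=> xK; apply: memv_suml => i _; rewrite KM // KX.
have phi_lin a x : phi a (emb x) = \sum_i x 0 i *: phi a (e (wid i)).
  rewrite /phi (eq_bigr (fun i : 'I_r => \sum_j x 0 j *: (vec (a i) * e (wid j) ^+ (q ^ i)))).
    by rewrite exchange_big; apply: eq_bigr => j _; rewrite scaler_sumr.
  move=> i _; rewrite exp_lincomb mulr_sumr.
  by apply: eq_bigr => j _; rewrite scalerAr.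
exists (fun a => \matrix_(i, j) coord X j (phi a (e (wid i)))) => a b neqab.
pose P : {poly L} := \sum_(i < r) (vec (a i) - vec (b i)) *: 'X^(q ^ i).
have Pphi x : P.[x] = phi a x - phi b x.
  rewrite /P horner_sum -sumrB; apply: eq_bigr => i _.
  by rewrite hornerZ hornerXn mulrBl.
have P0 : P != 0.
  have [i neqi] : exists i, a i != b i.
    by apply/existsP; apply: contraR neqab => /existsPn eqab; apply/eqP/ffunP => i;
       apply/eqP; have := eqab i; rewrite negbK.
  apply: contraNneq neqi => P0; apply/eqP/vec_inj/eqP; rewrite -subr_eq0.
  have := congr1 (fun p : {poly L} => p`_(q ^ i)) P0; rewrite coef0 coef_sumMXn.
  rewrite (bigD1 i) //= big1 ?addr0 => [-> //|j /andP[eqij]].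
  by rewrite eqn_exp2l ?q1 // in eqij; move/eqP/val_inj: eqij => ->; rewrite eqxx.
have szP : (size P <= (q ^ r.-1).+1)%N.
  apply: leq_trans (size_sum _ _ _) _; apply/bigmax_leqP => i _.
  apply: leq_trans (size_scale_leq _ _) _; rewrite size_polyXn ltnS.
  by rewrite leq_exp2l ?q1 //; have := ltn_ord i; nlia.
pose rs := [seq emb x | x <- enum [set x : 'rV[F]_k | x *m
  (\matrix_(i, j) coord X j (phi a (e (wid i)))
     - \matrix_(i, j) coord X j (phi b (e (wid i)))) == 0]].
have := @max_poly_roots _ P rs P0; rewrite size_map -cardE => lt1.
rewrite -ltnS; apply: leq_trans szP; apply: lt1; last by rewrite map_inj_uniq ?enum_uniq.
apply/allP => _ /mapP[x + ->]; rewrite mem_enum inE => /eqP x0.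
rewrite rootE Pphi !phi_lin -sumrB; apply/eqP.
set w := \sum_i _.
have wK : w \in K by apply: memv_suml => i _; rewrite memvB // memvZ // phiK.
rewrite (coord_vbasis wK) big1 // => j _.
have := congr1 (fun z : 'rV_(\dim K) => z 0 j) x0; rewrite !mxE => x0j.
rewrite -[RHS](scale0r (vbasis K)`_j) -[in RHS]x0j; congr (_ *: _).
rewrite /w linear_sum; apply: eq_bigr => i _.
by rewrite !mxE linearB !linearZ /= mulrBr.
Qed.

End Gabidulin.

(** * Lifting matrix codes to families of subspaces *)

Section LiftedCodes.
Variable F : finFieldType.
Local Notation q := #|F|.
Local Notation q1 := (card_field_gt1 F).

Let lift_mx k m (C : 'M[F]_(k, m)) : {vspace 'rV[F]_(k + m)} :=
  limg (linfun (mulmxr (row_mx 1%:M C) : 'rV[F]_k -> 'rV[F]_(k + m))).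

Let lift_mxP k m (C : 'M[F]_(k, m)) v :
  reflect (exists x, v = row_mx x (x *m C)) (v \in lift_mx C).
Proof.
apply: (iffP memv_imgP) => [[x _ ->]|[x ->]]; exists x; rewrite ?memvf //.
  by rewrite lfunE /= mul_mx_row mulmx1.
by rewrite lfunE /= mul_mx_row mulmx1.
Qed.

Let dim_lift_mx k m (C : 'M[F]_(k, m)) : \dim (lift_mx C) = k.
Proof.
rewrite /lift_mx limg_dim_eq ?dim_rV //.
apply/eqP; rewrite -subv0; apply/subvP => x; rewrite memv_cap memvf memv_ker lfunE /=.
rewrite mul_mx_row mulmx1 -row_mx0 => /eqP/eq_row_mx[-> _].
by rewrite mem0v.
Qed.

(** [s a] is the row space of (I | C a) and W that of (0 | I). The intersection of [s a] and [s b]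
    is given by the x with x C a = x C b, at most q^(r-1) vectors. *)
Lemma lifted_code n k m r : n = (k + m)%N -> (k <= m)%N -> (0 < m)%N -> (0 < r)%N ->
  exists (s : {ffun 'I_r -> 'rV[F]_m} -> {vspace 'rV[F]_n}) (W : {vspace 'rV[F]_n}),
  [/\ forall a, \dim (s a) = k, \dim W = m,
      forall a b, a != b -> (\dim (s a :&: s b) < r)%N
    & forall a, \dim (s a :&: W) = 0%N].
Proof.
move=> -> lekm m0 r0; have [C hC] := gabidulin F r lekm m0.
exists (fun a => lift_mx (C a)).
exists (limg (linfun (mulmxr (row_mx 0 1%:M) : 'rV[F]_m -> 'rV[F]_(k + m)))).
split=> [a||a b /hC|a].
- exact: dim_lift_mx.
- rewrite limg_dim_eq ?dim_rV //.
  apply/eqP; rewrite -subv0; apply/subvP => x; rewrite memv_cap memvf memv_ker lfunE /=.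
  rewrite mul_mx_row mulmx1 -row_mx0 => /eqP/eq_row_mx[_ ->].
  by rewrite mem0v.
- move=> leq; rewrite -(prednK r0) ltnS -(leq_exp2l _ _ q1) -card_vspace.
  apply: leq_trans leq.
  rewrite -(card_in_imset (f := lsubmx) (D := mem (lift_mx (C a) :&: lift_mx (C b))%VS)).
    apply/subset_leq_card/subsetP => _ /imsetP[v + ->].
    rewrite memv_cap => /andP[/lift_mxP[x ->] /lift_mxP[y /eq_row_mx[<- eqx]]].
    by rewrite inE row_mxKl mulmxBr eqx subrr.
  move=> u v; rewrite !memv_cap => /andP[/lift_mxP[x ->] _] /andP[/lift_mxP[y ->] _].
  by rewrite !row_mxKl => ->.
- apply/eqP; rewrite dimv_eq0 -subv0; apply/subvP => v; rewrite memv_cap.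
  case/andP=> /lift_mxP[x ->] /memv_imgP[y _]; rewrite lfunE /= mul_mx_row mulmx0.
  by case/eq_row_mx=> -> _; rewrite mul0mx row_mx0 mem0v.
Qed.

End LiftedCodes.

(** * Intersecting families *)

Section Intersecting.
Variables (F : finFieldType) (n : nat).
Local Notation V := 'rV[F]_n.
Local Notation q := #|F|.
Local Notation G := (gauss_binom q).
Local Notation Q := (q%:R : rat).
Local Notation q1 := (card_field_gt1 F).
Implicit Types (A B U W X E H : {vspace V}) (S T : {set {vspace V}}).

Lemma subspacesE k : subspaces F n k = btw 0 fullv k.
Proof. by apply/setP => A; rewrite !inE sub0v subvf. Qed.

Lemma in_subspaces k A : (A \in subspaces F n k) = (\dim A == k).
Proof. by rewrite inE. Qed.

(** Of the q^(m r) images of the code spaces under one matrix an r-intersecting family contains at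
    most one, as they meet pairwise in dimension below r. *)
Lemma intersecting_code_bound k m r S : n = (k + m)%N -> (k <= m)%N -> (0 < m)%N ->
  (0 < r)%N -> S \subset subspaces F n k -> intersecting r S ->
  #|S|%:R * Q ^+ (m * r) <= G n k.
Proof.
move=> def_n lekm m0 r0 sS iS.
have [s [W [ds _ cs _]]] := lifted_code F def_n lekm m0 r0.
have lekn : (k <= n)%N by rewrite def_n leq_addr.
have := @clique_bound _ _ _ s (fun=> S); rewrite (eq_bigr (fun=> #|S|%:R / G n k)); last first.
  by move=> a _; rewrite ds.
rewrite big_const iter_addr addr0 card_ffun card_ord card_mx mul1n -expnM.
rewrite -[_ *+ (_ ^ _)%N]mulr_natl natrX => le1.
rewrite mulrC -[leRHS]mul1r -ler_pdivrMr ?gauss_gt0 ?q1 // -mulrA.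
apply: le1 => [a|M a b uM sa sb]; first by rewrite ds.
apply/eqP; apply: contraLR (iS _ _ sa sb) => /cs.
by rewrite -mxact_cap // dim_mxact // -ltnNge.
Qed.

Lemma complement_ex k : (k <= n)%N -> exists U W,
  [/\ \dim U = k, \dim W = (n - k)%N & \dim (U :&: W) = 0%N].
Proof.
move=> lekn; have [|U [_ _ dU]] := btw_ex (k := k) (sub0v {:V}%VS).
  by rewrite dimv0 dim_rV.
exists U, U^C%VS; split=> //; first by rewrite dimv_compl dim_rV dU.
by rewrite capv_compl dimv0.
Qed.

Lemma notin2_ex U U' : (\dim U < n)%N -> (\dim U' < n)%N ->
  exists2 v, v \notin U & v \notin U'.
Proof.
move=> dU dU'.
have [|v _ vU] := @notin_vspace_ex _ _ U {:V}%VS; first by rewrite dim_rV.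
have [|v' _ vU'] := @notin_vspace_ex _ _ U' {:V}%VS; first by rewrite dim_rV.
have [vU1|vU1] := boolP (v \in U'); last by exists v.
have [vU2|vU2] := boolP (v' \in U); last by exists v'.
by exists (v + v'); [rewrite rpredDr | rewrite rpredDl].
Qed.

(** Induction on the codimension: a vector v outside both spaces is added to them, and then moved
    into the common complement of the enlarged spaces. Such a v exists because two proper subspaces
    never cover V. *)
Lemma common_complement U U' : \dim U = \dim U' ->
  exists W, [/\ \dim W = (n - \dim U)%N, \dim (U :&: W) = 0%N & \dim (U' :&: W) = 0%N].
Proof.
move: {2}(n - _)%N (erefl (n - \dim U)%N) => c.
elim: c U U' => [|c IH] U U' def_c eqd.
  by exists 0%VS; rewrite !capv0 dimv0 def_c.
have ltU : (\dim U < n)%N by nlia.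
have ltU' : (\dim U' < n)%N by rewrite -eqd.
have [v vU vU'] := notin2_ex ltU ltU'.
have dUv := dim_add_line vU; have dUv' := dim_add_line vU'.
have [||W [dW dUW dUW']] := IH (U + <[v]>)%VS (U' + <[v]>)%VS.
- by rewrite dUv; nlia.
- by rewrite dUv dUv' eqd.
have dW1 : (\dim (W + <[v]>) <= (\dim W).+1)%N.
  have := dimv_sum_cap W <[v]>; rewrite dim_vline; case: (v != 0) => /=; nlia.
have key U1 : \dim U1 = \dim U -> v \notin U1 -> \dim ((U1 + <[v]>) :&: W) = 0%N ->
    \dim (U1 :&: (W + <[v]>)) = 0%N /\ \dim (W + <[v]>) = (n - \dim U)%N.
  move=> dU1 /dim_add_line dU1v d0.
  have := dimv_sum_cap U1 (W + <[v]>); rewrite (addvC W) addvA.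
  have := dimv_sum_cap (U1 + <[v]>) W; rewrite d0 dU1v (addvC <[v]>%VS).
  by move: dW1 ltU; rewrite dW dUv dU1; clear; lia.
have [dc1 dW'] := key _ (erefl _) vU dUW.
have [dc2 _] := key _ (esym eqd) vU' dUW'.
by exists (W + <[v]>)%VS.
Qed.

(** * Cross-intersecting families in complementary dimensions *)

Section CrossPair.
Variables (k : nat) (S1 S2 : {set {vspace V}}).
Hypotheses (lekn : (k <= n)%N).
Hypotheses (sS1 : S1 \subset subspaces F n k) (sS2 : S2 \subset subspaces F n (n - k)).
Hypothesis cross : forall A B, A \in S1 -> B \in S2 -> (0 < \dim (A :&: B))%N.

Let pair_clique (U W : {vspace V}) (s := fun b : bool => if b then U else W)
    (T := fun b : bool => if b then S1 else S2) :
  \dim U = k -> \dim W = (n - k)%N -> \dim (U :&: W) = 0%N ->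
  [/\ forall i, T i \subset subspaces F n (\dim (s i)),
      forall M i j, M \in unitmx ->
     mxact M (s i) \in T i -> mxact M (s j) \in T j -> i = j
   & \sum_i #|T i|%:R / G n (\dim (s i)) = (#|S1|%:R + #|S2|%:R) / G n k].
Proof.
move=> dU dW dUW; split=> [[]|M|]; rewrite ?dU ?dW //.
  have absurd N : N \in unitmx -> mxact N U \in S1 -> mxact N W \in S2 -> False.
    move=> uN h1 h2; have := cross h1 h2.
    by rewrite -mxact_cap // dim_mxact // dUW.
  by case=> [] [] //= uM h1 h2; exfalso; apply: (absurd M).
by rewrite big_bool /= dU dW gauss_sym ?q1 // mulrDl.
Qed.

Lemma cross_pair_bound : #|S1|%:R + #|S2|%:R <= G n k.
Proof.
have [U [W [dU dW dUW]]] := complement_ex lekn.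
have [c1 c2 c3] := pair_clique dU dW dUW.
have := clique_bound c1 c2; rewrite c3.
by rewrite ler_pdivrMr ?mul1r // gauss_gt0 ?q1.
Qed.

Lemma cross_pair_tight : #|S1|%:R + #|S2|%:R = G n k ->
  (S1 = subspaces F n k /\ S2 = set0) \/ (S1 = set0 /\ S2 = subspaces F n (n - k)).
Proof.
move=> tight; have G0 : 0 < G n k by rewrite gauss_gt0 ?q1.
have tightP U W : \dim U = k -> \dim W = (n - k)%N -> \dim (U :&: W) = 0%N ->
    U \in S1 \/ W \in S2.
  move=> dU dW dUW; have [c1 c2 c3] := pair_clique dU dW dUW.
  have [|i] := clique_tight c1 c2; first by rewrite c3 tight divff // gt_eqF.
  by case: i; [left|right].
have [S10|[U US1]] := set_0Vmem S1; [right|left].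
  split=> //; apply/eqP; rewrite eqEcard sS2 -(ler_nat rat) card_subspaces.
  by rewrite gauss_sym ?q1 // -tight S10 cards0 add0r lexx.
have dU : \dim U = k by apply/eqP; rewrite -in_subspaces (subsetP sS1).
have eqS1 : S1 = subspaces F n k.
  apply/eqP; rewrite eqEsubset sS1; apply/subsetP => U'; rewrite in_subspaces => /eqP dU'.
  have [|W [dW dUW dUW']] := @common_complement U U'; first by rewrite dU.
  rewrite dU in dW; case: (tightP U' W dU' dW dUW') => // WS2.
  by have := cross US1 WS2; rewrite dUW.
split=> //; apply/eqP; rewrite -cards_eq0 -(eqr_nat rat); apply/eqP.
by move: tight; rewrite eqS1 card_subspaces; lra.
Qed.

End CrossPair.

Lemma up_iter E S j k : up E (up E S k) j \subset up E S j.
Proof.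
apply/subsetP => W /upP[sWE dW [B /upP[_ _ [A AS sAB]] sBW]].
by apply/upP; split=> //; exists A => //; apply: subv_trans sBW.
Qed.

(** Iterates [shadow_growth]: under either alternative the shadow of a family of at least star size
    has at least star size one dimension up. The iteration starts at j = k, where the shadow
    contains S. *)
Lemma up_ge S e k j : n = e.+1 -> (k <= j <= e)%N ->
  S \subset subspaces F n k.+1 -> G e k <= #|S|%:R ->
  G e j <= #|up fullv S j.+1|%:R.
Proof.
move=> def_n; elim: j => [|j IH] /andP[lekj leje] sS geS.
  have k0 : k = 0%N by nlia.
  rewrite k0 in geS sS; apply: le_trans geS _; rewrite ler_nat.
  apply/subset_leq_card/subsetP => A AS; apply/upP; split; rewrite ?subvf //.
    by apply/eqP; rewrite -in_subspaces (subsetP sS).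
  by exists A; rewrite ?subvv.
have [ltjk|lekj'] := ltnP j k.
  have kj : k = j.+1 by nlia.
  rewrite kj in geS sS; apply: le_trans geS _; rewrite ler_nat.
  apply/subset_leq_card/subsetP => A AS; apply/upP; split; rewrite ?subvf //.
    by apply/eqP; rewrite -in_subspaces (subsetP sS).
  by exists A; rewrite ?subvv.
have {IH} geUp := IH (introT andP (conj lekj' (ltnW leje))) sS geS.
apply: (@le_trans _ _ #|up fullv (up fullv S j.+1) j.+2|%:R); last first.
  by rewrite ler_nat subset_leq_card // up_iter.
have dE : \dim {:V} = e.+1 by rewrite dim_rV.
have sUp : up fullv S j.+1 \subset btw 0 {:V}%VS j.+1.
  by apply/subsetP => W /upP[sWE dW _]; rewrite in_btw sub0v sWE dW /=.
case: (shadow_growth dE leje sUp) => [||[] //].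
  rewrite -card_gt0 -(ltr_nat rat); apply: lt_le_trans geUp.
  by rewrite gauss_gt0 ?q1 // ltnW.
move=> lt1; have Qj := expqB1_gt0 q1 (ltn0Sn j).
rewrite -(ler_pM2r Qj) (gauss_ratio q1 (ltnW leje)); apply: le_trans (ltW lt1).
by rewrite ler_wpM2r // expqB1_ge0 ?q1.
Qed.

(** * The Erdős-Ko-Rado theorem for vector spaces *)

Section ErdosKoRado.
Variables (e : nat).
Hypothesis def_n : n = e.+1.

(* [q^(n-k)] pairwise disjoint k-spaces and one (n-k)-space disjoint from them:
   at most one of them lies in the family or in its upper shadow. *)
Let ekr_clique k S : (k.+1.*2 <= n)%N -> S \subset subspaces F n k.+1 ->
  intersecting 1 S ->
  #|up fullv S (n - k.+1)|%:R + Q ^+ (n - k.+1) * #|S|%:R <= G n k.+1.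
Proof.
move=> le2k sS iS; set m := (n - k.+1)%N.
have def_m : n = (k.+1 + m)%N by rewrite /m; nlia.
have lekm : (k.+1 <= m)%N by rewrite /m; nlia.
have [s [W [ds dW cs cW]]] := lifted_code F def_m lekm (leq_trans (ltn0Sn k) lekm) (ltnSn 0).
pose s' (i : unit + {ffun 'I_1 -> 'rV[F]_m}) := if i is inr a then s a else W.
pose T (i : unit + {ffun 'I_1 -> 'rV[F]_m}) := if i is inr a then S else up fullv S m.
have : \sum_i #|T i|%:R / G n (\dim (s' i)) <= 1.
  apply: clique_bound => [[[]|a]|M i j uM] /=.
  - by rewrite dW; apply/subsetP => B /upP[_ dB _]; rewrite in_subspaces dB.
  - by rewrite ds.
  have absurd a : mxact M (s a) \in S -> mxact M W \in up fullv S m -> False.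
    move=> h1 /upP[_ _ [A AS sAW]]; have := iS _ _ h1 AS.
    have /dimvS := capvS (subvv (mxact M (s a))) sAW.
    by rewrite -mxact_cap // dim_mxact // cW; nlia.
  case: i j => [[]|a] [[]|b] //= h1 h2; [by case: (absurd b)|by case: (absurd a)|].
  congr inr; apply/eqP; apply: contraLR (iS _ _ h1 h2) => /cs.
  by rewrite -mxact_cap // dim_mxact // -ltnNge.
rewrite big_sumType /= big_const card_unit /= addr0 dW.
rewrite (eq_bigr (fun=> #|S|%:R / G n k.+1)) => [|a _]; last by rewrite ds.
rewrite big_const iter_addr addr0 card_ffun card_ord card_mx mul1n expn1.
have -> : G n m = G n k.+1 by rewrite gauss_sym ?q1 //; nlia.
rewrite -[_ *+ (_ ^ _)%N]mulr_natl natrX mulrA -mulrDl ler_pdivrMr ?mul1r // gauss_gt0 ?q1 //; nlia.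
Qed.

(** If S reaches the size of a star, its shadow in dimension n - k - 1 has at least [e,k+1] elements
    by [up_ge]; by Pascal's rule the clique bound then leaves at most [e,k] for S. *)
Lemma ekr_bound k S : (k.+1.*2 <= n)%N -> S \subset subspaces F n k.+1 ->
  intersecting 1 S -> #|S|%:R <= G e k.
Proof.
move=> le2k sS iS; have [/ltW//|geS] := ltrP #|S|%:R (G e k).
have lek : (k <= e)%N by nlia.
have := ekr_clique le2k sS iS.
have := up_ge (j := (e - k).-1) def_n _ sS geS; rewrite prednK; last by nlia.
have -> : (n - k.+1 = e - k)%N by nlia.
have -> : G e (e - k).-1 = G e k.+1.
  by rewrite -(gauss_sym q1 (_ : k.+1 <= e)%N); [congr (G _ _)|]; nlia.
rewrite (_ : G n k.+1 = G e k.+1 + Q ^+ (e - k) * G e k); last first.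
  by rewrite def_n gauss_pascalr ?q1.
move=> geUp leS.
have Qm : 0 < Q ^+ (e - k) by rewrite exprn_gt0 // ltr0n ltnW ?q1.
have {}geUp : G e k.+1 <= #|up fullv S (e - k)|%:R by apply: geUp; nlia.
by rewrite -(ler_pM2l Qm); lra.
Qed.

Lemma ekr_star k S : (k.+1.*2 < n)%N -> S \subset subspaces F n k.+1 ->
  intersecting 1 S -> #|S|%:R = G e k ->
  exists2 X, \dim X = 1%N & forall A, A \in S -> (X <= A)%VS.
Proof.
move=> lt2k sS iS eqS; have lek : (k <= e)%N by nlia.
have upS : #|up fullv S k.+2|%:R <= G e k.+1.
  (* The shadow of an intersecting family is intersecting, so the bound applies to it unless 2(k +
     2) > n. In that case n = 2k + 3, and k + 2 = n - k - 1 is the dimension of the shadow in the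
     clique bound. *)
  have [le2k|gt2k] := leqP k.+2.*2 n.
    apply: ekr_bound => //.
      by apply/subsetP => B /upP[_ dB _]; rewrite in_subspaces dB.
    move=> B B' /upP[_ _ [A AS sAB]] /upP[_ _ [A' AS' sAB']].
    exact: leq_trans (iS _ _ AS AS') (dimvS (capvS sAB sAB')).
  have := ekr_clique (ltnW lt2k) sS iS; rewrite eqS.
  have -> : (n - k.+1 = k.+2)%N by nlia.
  rewrite (_ : G n k.+1 = G e k.+1 + Q ^+ (e - k) * G e k); last first.
    by rewrite def_n gauss_pascalr ?q1.
  by rewrite (_ : e - k = k.+2)%N ?lerD2r //; nlia.
have [e' def_e] : exists e', e = e'.+1 by exists e.-1; nlia.
apply: (@shadow_star _ _ {:V}%VS S e' k); rewrite -?def_e ?eqS -?subspacesE //.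
  by rewrite dim_rV def_n.
by nlia.
Qed.

End ErdosKoRado.


End Intersecting.

(** * Orthogonal complements *)

Section Perp.
Variables (F : finFieldType) (n : nat) (b : {biscalar 'rV[F]_n}).
Hypothesis nondeg : nondegenerate_form b.
Local Notation V := 'rV[F]_n.
Implicit Types (U W : {vspace V}) (fam : {set {vspace V}}).

Lemma perpD U W : perp b (U + W) = (perp b U :&: perp b W)%VS.
Proof.
apply/vspaceP => u; rewrite memv_cap.
apply/mem_perp/andP => [h|[/mem_perp hU /mem_perp hW] v /memv_addP[x xU [y yW ->]]].
  by split; apply/mem_perp => v vU; apply: h;
     [apply: (subvP (addvSl _ _)) | apply: (subvP (addvSr _ _))].
by rewrite linearDr /= hU ?hW ?addr0.
Qed.

(** Each further basis vector of U imposes one linear equation and costs at most one dimension. *)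
Let dim_perp_ge U : (n <= \dim (perp b U) + \dim U)%N.
Proof.
move: {2}(\dim U) (erefl (\dim U)) => k; elim: k U => [|k IH] U dU.
  have -> : perp b U = fullv; last by rewrite dim_rV leq_addr.
  apply/vspaceP => u; rewrite memvf; apply/mem_perp => v.
  have /eqP -> : U == 0%VS by rewrite -dimv_eq0 dU.
  by rewrite memv0 => /eqP ->; rewrite linear0r.
have [|U' [_ sU' dU']] := btw_ex (k := k) (sub0v U); first by rewrite dimv0 dU /=.
have [|v vU vU'] := @notin_vspace_ex _ _ U' U; first by rewrite dU' dU.
have defU : U = (U' + <[v]>)%VS.
  by apply/esym/eq_sub_dim; rewrite ?subv_add ?sU' -?memvE // dim_add_line // dU dU'.
have dv : (n <= (\dim (perp b <[v]>)).+1)%N.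
  pose g : 'Hom(V, F^o) := linfun (applyr b v : V -> F^o).
  have <- : lker g = perp b <[v]>.
    apply/vspaceP => u; rewrite memv_ker lfunE /=.
    apply/eqP/mem_perp => [uv0 _ /vlineP[a ->]|]; last by apply; rewrite memv_line.
    by rewrite linearZr /= uv0 mulr0.
  have dg : (\dim (limg g) <= 1)%N.
    by apply: leq_trans (dimvS (subvf _)) _; rewrite dimvf.
  have := limg_ker_dim g fullv; rewrite capfv dim_rV => eqn.
  apply: (@leq_trans (\dim (lker g) + \dim (limg g))%N); first by rewrite eqn.
  by apply: leq_trans (leq_add (leqnn _) dg) _; rewrite addn1.
have := dimv_sum_cap (perp b U') (perp b <[v]>); rewrite -perpD -defU.
have := IH _ dU'; have := dim_le (perp b U' + perp b <[v]>).
by move: dv; rewrite dU dU'; clear; lia.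
Qed.

(** The inequality for U and for a complement suffices: the two perps meet in the perp of V, which
    is 0 by nondegeneracy, so their dimensions add up to at most n. *)
Lemma dim_perp U : \dim (perp b U) = (n - \dim U)%N.
Proof.
have perpT : perp b fullv = 0%VS.
  apply/eqP; rewrite -subv0; apply/subvP => u /mem_perp u0.
  by rewrite (nondeg (u := u)) ?mem0v // => v; rewrite u0 ?memvf.
have := dimv_sum_cap (perp b U) (perp b U^C).
rewrite -perpD addv_complf perpT dimv0.
have := dim_perp_ge U; have := dim_perp_ge U^C; rewrite dimv_compl dim_rV.
have := dim_le U; have := dim_le (perp b U + perp b U^C).
by clear; lia.
Qed.

(** If the perps of U and W agree, they agree with that of U + W, so all three spaces have the same
    dimension. *)
Lemma perp_inj : injective (perp b).
Proof.
move=> U W eqp; have := dim_perp (U + W); have := dim_perp U; have := dim_perp W.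
rewrite perpD eqp capvv => -> dU dUW.
have sU := addvSl U W; have sW := addvSr U W.
have key : (\dim (U + W) <= \dim U)%N /\ (\dim (U + W) <= \dim W)%N.
  have := (dim_le U, dim_le W, dim_le (U + W)); move: dU dUW; clear.
  by move=> dU dUW [[]]; nlia.
by rewrite {1}(eq_sub_dim sU key.1) -(eq_sub_dim sW key.2).
Qed.

(** The diameter bound without the maximum and the truncated subtraction, as a lower bound on
    [\dim (U :&: W)]. *)
Definition close (d : nat) fam := forall U W, U \in fam -> W \in fam ->
  (\dim U + \dim W <= d + 2 * \dim (U :&: W))%N.

Lemma diam_close d fam : (diam fam <= d)%N -> close d fam.
Proof.
move=> /bigmax_leqP h U W UF WF; have /bigmax_leqP := h U UF => /(_ W WF).
by rewrite /delta; have := dimv_sum_cap U W; nlia.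
Qed.

Lemma close_perp d fam : close d fam -> close d (perp_family b fam).
Proof.
move=> cl _ _ /imsetP[U UF ->] /imsetP[W WF ->]; have := cl _ _ UF WF.
rewrite -perpD !dim_perp; have := dimv_sum_cap U W.
have := (dim_le U, dim_le W, dim_le (U + W)) => -[[]]; clear; lia.
Qed.

Lemma layer_perp fam k : (k <= n)%N ->
  layer (perp_family b fam) k = perp b @: layer fam (n - k).
Proof.
move=> lekn; apply/setP => A; apply/setIP/imsetP => [[/imsetP[U UF ->]]|[U]].
  rewrite in_subspaces dim_perp => /eqP dU; exists U => //.
  by rewrite inE UF in_subspaces; have := dim_le U; nlia.
rewrite inE in_subspaces => /andP[UF /eqP dU] ->; split.
  by apply/imsetP; exists U.
by rewrite in_subspaces dim_perp dU; nlia.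
Qed.

Lemma card_layer_perp fam k : (k <= n)%N ->
  #|layer (perp_family b fam) k| = #|layer fam (n - k)|.
Proof. by move=> lekn; rewrite layer_perp // card_imset //; apply: perp_inj. Qed.

Lemma card_perp_family fam : #|perp_family b fam| = #|fam|.
Proof. by rewrite card_imset //; apply: perp_inj. Qed.

End Perp.

(** * Layers of a family of bounded diameter *)

Section Layers.
Variables (F : finFieldType) (n d : nat).
Local Notation V := 'rV[F]_n.
Local Notation q := #|F|.
Local Notation G := (gauss_binom q).
Local Notation Q := (q%:R : rat).
Local Notation q1 := (card_field_gt1 F).
Implicit Types (A B U W X : {vspace V}) (fam : {set {vspace V}}).

Lemma in_layer fam k A : (A \in layer fam k) = (A \in fam) && (\dim A == k).
Proof. by rewrite inE in_subspaces. Qed.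

Lemma layer_sub fam k : layer fam k \subset subspaces F n k.
Proof. exact: subsetIr. Qed.

Lemma card_layers fam : #|fam|%:R = \sum_(0 <= k < n.+1) #|layer fam k|%:R :> rat.
Proof.
rewrite -natr_sum big_mkord; congr (_%:R).
rewrite -sum1_card (partition_big (fun A : {vspace V} => inord (\dim A) : 'I_n.+1) predT) //=.
apply: eq_bigr => k _; rewrite -sum1_card; apply: eq_bigl => A.
rewrite in_layer; congr (_ && _); rewrite -val_eqE /= inordK // ltnS.
exact: dim_le.
Qed.

Section Close.
Variable fam : {set {vspace V}}.
Hypothesis cl : close d fam.
Local Notation f k := (#|layer fam k|%:R : rat).

Let layer_close k l A B : A \in layer fam k -> B \in layer fam l ->
  (k + l <= d + 2 * \dim (A :&: B))%N.
Proof.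
by rewrite !in_layer => /andP[AF /eqP <-] /andP[BF /eqP <-]; apply: cl.
Qed.

Lemma layer_pair k : (d < n)%N -> (k <= n)%N -> f k + f (n - k) <= G n k.
Proof.
move=> ltdn lekn; apply: cross_pair_bound; rewrite ?layer_sub // => A B Ak Bk.
by have := layer_close Ak Bk; nlia.
Qed.

Lemma layer_pair_tight k : (d < n)%N -> (k <= n)%N -> f k + f (n - k) = G n k ->
  (layer fam k = subspaces F n k /\ layer fam (n - k) = set0)
  \/ (layer fam k = set0 /\ layer fam (n - k) = subspaces F n (n - k)).
Proof.
move=> ltdn lekn; apply: cross_pair_tight; rewrite ?layer_sub // => A B Ak Bk.
by have := layer_close Ak Bk; nlia.
Qed.

(** By the dimension hypothesis every member of dimension k + 1 meets B, hence contains a point of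
    B; each point lies in [n-1,k] spaces of that dimension. *)
Lemma layer_point B k : B \in fam -> (d < k.+1 + \dim B)%N ->
  f k.+1 <= G (\dim B) 1 * G n.-1 k.
Proof.
move=> BF ltd; pose P := btw 0 B 1.
have cardP : #|P|%:R = G (\dim B) 1 
    by rewrite card_btw ?sub0v ?dimv0 // !subn0.
have := double_count (fun A X => (X <= A)%VS) (layer fam k.+1) P.
move/(congr1 (fun m : nat => m%:R : rat)) => eqd.
apply: (@le_trans _ _ (\sum_(A in layer fam k.+1) #|[set X in P | (X <= A)%VS]|)%:R).
  rewrite ler_nat -sum1_card; apply: leq_sum => A; rewrite in_layer => /andP[AF /eqP dA].
  have := cl AF BF; rewrite dA => le1.
  have [|X sX dX] := @point_ex _ _ (A :&: B)%VS; first by nlia.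
  apply/card_gt0P; exists X; rewrite !inE sub0v dX.
  by move: sX; rewrite subv_cap => /andP[-> ->].
rewrite eqd -cardP natr_sum mulr_natl -[leRHS]addr0 -iter_addr -big_const.
apply: ler_sum => X; rewrite in_btw => /and3P[_ _ /eqP dX].
rewrite -(card_star _ dX) ler_nat; apply/subset_leq_card/subsetP => A.
by rewrite !inE => /andP[/andP[_ ->] ->].
Qed.

(** For odd d the half is rounded up in the dimension of the intersection, so one statement serves d
    = 2t and d = 2t + 1. *)
Lemma layer_intersecting t k : (d <= t.*2.+1)%N -> (t < k)%N ->
  intersecting (k - t) (layer fam k).
Proof. by move=> led ltk A B Ak Bk; have := layer_close Ak Bk; nlia. Qed.

Lemma layer_ekr t : (d <= t.*2.+1)%N -> (t.+1.*2 <= n)%N -> f t.+1 <= G n.-1 t.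
Proof.
move=> led le2t; apply: (ekr_bound (F := F) (n := n)) => //; last 2 first.
- exact: layer_sub.
- by have := layer_intersecting led (ltnSn t); rewrite subSnn.
by rewrite prednK //; nlia.
Qed.

Lemma layer_star t : (d <= t.*2.+1)%N -> (t.+1.*2 < n)%N -> f t.+1 = G n.-1 t ->
  exists2 X, \dim X = 1%N
    & layer fam t.+1 = [set A in subspaces F n t.+1 | (X <= A)%VS].
Proof.
move=> led lt2t eqf.
have [||X dX allX] := ekr_star (F := F) (n := n) (e := n.-1) _ lt2t (layer_sub fam _) _ eqf.
- by rewrite prednK //; nlia.
- by have := layer_intersecting led (ltnSn t); rewrite subSnn.
exists X => //; apply/eqP; rewrite eqEcard -(ler_nat rat) card_star // eqf lexx andbT.
apply/subsetP => A Ak; rewrite inE allX // andbT.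
exact: (subsetP (layer_sub fam _)).
Qed.

(** Each quotient [n,i+1]/[n,i] = (q^(n-i)-1)/(q^(i+1)-1) with i >= t is at most
    q^(n-2i+t)/(q^(t+1)-1). The factor q^((n-k)j) with k = t + j is the size of the lifted code and
    cancels in [layer_code]. *)
Lemma gauss_code_le t j : (t + j <= n - (t + j))%N ->
  G n (t + j) * (Q ^+ t.+1 - 1) ^+ j <= Q ^+ ((n - (t + j)) * j + j) * G n t.
Proof.
elim: j => [|j IH]; first by rewrite addn0 muln0 !expr0 mulr1 mul1r.
move=> lej; set m := (n - (t + j))%N.
have m1 : (n - (t + j.+1) = m.-1)%N by rewrite /m; nlia.
have m0 : (j < m)%N by rewrite /m; nlia.
have {}IH : G n (t + j) * (Q ^+ t.+1 - 1) ^+ j <= Q ^+ (m * j + j) * G n t.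
  by apply: IH; nlia.
have Qj := expqB1_gt0 q1 (ltn0Sn (t + j)).
rewrite -(ler_pM2r Qj) m1 addnS.
have -> : G n (t + j).+1 * (Q ^+ t.+1 - 1) ^+ j.+1 * (Q ^+ (t + j).+1 - 1)
  = (G n (t + j) * (Q ^+ t.+1 - 1) ^+ j) * ((Q ^+ m - 1) * (Q ^+ t.+1 - 1)).
  rewrite mulrAC gauss_ratio ?q1 //; last by nlia.
  by rewrite exprS -/m; ring.
have -> : (m.-1 * j.+1 + j.+1 = (m * j + j) + (m - j))%N.
  by case: (m) m0 => // m'; rewrite ltnS => /subnKC <-; nia.
rewrite exprD.
have -> : Q ^+ (m * j + j) * Q ^+ (m - j) * G n t * (Q ^+ (t + j).+1 - 1)
  = (Q ^+ (m * j + j) * G n t) * (Q ^+ (m - j) * (Q ^+ (t + j).+1 - 1)) by ring.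
apply: ler_pM => //.
- by rewrite mulr_ge0 ?gauss_ge0 ?exprn_ge0 ?expqB1_ge0 ?q1.
- by rewrite mulr_ge0 ?expqB1_ge0 ?q1.
have -> : Q ^+ (m - j) * (Q ^+ (t + j).+1 - 1) = Q ^+ m * Q ^+ t.+1 - Q ^+ (m - j).
  by rewrite mulrBr mulr1 -!exprD; congr (_ ^+ _ - _); nlia.
have le1 : Q ^+ (m - j) <= Q ^+ m.
  by rewrite ler_weXn2l ?leq_subr // (ler_nat _ 1) ltnW ?q1.
have := expq_ge1 q1 t.+1; rewrite mulrBl !mulrBr !mulr1 !mul1r; lra.
Qed.

Lemma layer_code t k : (d <= t.*2.+1)%N -> (1 < t)%N -> (t < k)%N -> (k <= n - k)%N ->
  f k <= (2 / 7) ^+ (k - t) * G n t.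
Proof.
move=> led t1 ltk lek; set j := (k - t)%N.
have def_k : k = (t + j)%N by rewrite /j; nlia.
have code : f k * Q ^+ ((n - k) * j) <= G n k.
  apply: intersecting_code_bound; rewrite ?layer_sub //; try nlia.
  exact: layer_intersecting.
have := @gauss_code_le t j; rewrite -def_k => /(_ lek); rewrite exprD => le2.
have Qt : 0 < Q ^+ t.+1 - 1 by apply: expqB1_gt0; rewrite ?q1.
have Qj : 0 < (Q ^+ t.+1 - 1) ^+ j by rewrite exprn_gt0.
have Q0 : 0 < Q by rewrite ltr0n ltnW ?q1.
have Qm : 0 < Q ^+ ((n - k) * j) by rewrite exprn_gt0.
have le3 : f k * (Q ^+ t.+1 - 1) ^+ j <= Q ^+ j * G n t.
  rewrite -(ler_pM2r Qm); have := ler_wpM2r (ltW Qj) code.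
  by set x := Q ^+ ((n - k) * j) in le2 *; nra.
(* At q = t = 2 the bases are equal: 2 = 2/7 * (8 - 1). *)
have le4 : Q ^+ j <= (2 / 7 * (Q ^+ t.+1 - 1)) ^+ j.
  have x0 : 0 <= 2 / 7 * (Q ^+ t.+1 - 1) by lra.
  rewrite lerXn2r ?nnegrE ?(ltW Q0) ?x0 //.
  have : Q ^+ 3 <= Q ^+ t.+1 by rewrite ler_weXn2l // (ler_nat _ 1) ltnW ?q1.
  by have := q_ge2 q1; rewrite !exprS expr0; nra.
rewrite -(ler_pM2r Qj); apply: le_trans le3 _.
rewrite mulrAC -exprMn; by apply: ler_wpM2r le4; apply: gauss_ge0 q1 _ _.
Qed.

End Close.
End Layers.

(** * Numerical estimates *)

Section Estimates.
Variable q : nat.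
Hypothesis q_gt1 : (1 < q)%N.
Local Notation G := (gauss_binom q).
Local Notation Q := (q%:R : rat).

(** Over the common denominator q^n - 1 the comparisons below become polynomial inequalities in q
    and two of its powers. *)
Lemma gauss_pred_scaled n t : (t < n)%N ->
  G n.-1 t.+1 * (Q ^+ n - 1) = G n t.+1 * (Q ^+ (n - t.+1) - 1)
  /\ G n.-1 t * (Q ^+ n - 1) = G n t.+1 * (Q ^+ t.+1 - 1).
Proof.
case: n => // e; rewrite ltnS subSS /= => lete; split; last by rewrite gaussSS // mulrC.
have Qt := expqB1_neq0 q_gt1 (ltn0Sn t).
by apply: (mulIf Qt); rewrite mulrAC gauss_ratio // [RHS]mulrAC gaussSS //; ring.
Qed.

(** c is the number of dimensions by which m falls short of n - t - 1; each gains a factor q. Below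
    c is 1, 2 or 3. *)
Lemma gauss1_scaled m n t c : (t.+1 + m + c = n)%N -> (0 < c)%N ->
  G m 1 * G n.-1 t * (Q ^+ n - 1) * (Q - 1)
    = (Q ^+ m - 1) * (Q ^+ t.+1 - 1) * G n t.+1
  /\ Q ^+ n = Q ^+ t.+1 * Q ^+ m * Q ^+ c.
Proof.
move=> def_n c0; split; last by rewrite -def_n !exprD.
have [|_ e2] := @gauss_pred_scaled n t; first by nlia.
transitivity ((G m 1 * (Q - 1)) * (G n.-1 t * (Q ^+ n - 1))); first by ring.
by rewrite e2 gauss1 //; ring.
Qed.

(** The budget when the layers at both ends of [core] are bounded by the points of a member and one
    more layer by the size of a star. *)
Lemma two_points_lt n t : (t.*2.+3 <= n)%N ->
  2 * (G (n - t.+2) 1 * G n.-1 t) + G n.-1 t.+1 < G n t.+1.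
Proof.
move=> ltn.
have [e1 eQ] := @gauss1_scaled (n - t.+2) n t 1 ltac:(nlia) isT.
have [e2 _] := @gauss_pred_scaled n t ltac:(nlia).
have Q2 := q_ge2 q_gt1; have g0 : 0 < G n t.+1 by rewrite gauss_gt0 //; nlia.
have Qn : 0 < Q ^+ n - 1 by rewrite expqB1_gt0 //; nlia.
have Q1 : 0 < Q - 1 by lra.
have eQc : Q ^+ (n - t.+1) = Q ^+ (n - t.+2) * Q by rewrite -exprSr; congr (_ ^+ _); nlia.
rewrite eQc in e2; rewrite expr1 in eQ.
have a1 := expq_gt1 q_gt1 (ltn0Sn t); have P1 := expq_ge1 q_gt1 (n - t.+2).
rewrite -(ltr_pM2r Qn) -(ltr_pM2r Q1).
have -> : (2 * (G (n - t.+2) 1 * G n.-1 t) + G n.-1 t.+1) * (Q ^+ n - 1) * (Q - 1)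
  = 2 * (G (n - t.+2) 1 * G n.-1 t * (Q ^+ n - 1) * (Q - 1))
    + G n.-1 t.+1 * (Q ^+ n - 1) * (Q - 1) by ring.
rewrite e1 e2 eQ; move: (Q ^+ t.+1) (Q ^+ (n - t.+2)) a1 P1 => a P a1 P1.
have -> : 2 * ((P - 1) * (a - 1) * G n t.+1) + G n t.+1 * (P * Q - 1) * (Q - 1)
  = (2 * ((P - 1) * (a - 1)) + (P * Q - 1) * (Q - 1)) * G n t.+1 by ring.
have -> : G n t.+1 * (a * P * Q - 1) * (Q - 1) = ((a * P * Q - 1) * (Q - 1)) * G n t.+1 by ring.
rewrite ltr_pM2r // -subr_gt0.
(* At q = 2 the coefficient of P vanishes, and only the summand 2 keeps the inequality strict. *)
have -> : (a * P * Q - 1) * (Q - 1) - (2 * ((P - 1) * (a - 1)) + (P * Q - 1) * (Q - 1))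
  = (a - 1) * (P * (Q * (Q - 1) - 2) + 2) by ring.
apply: mulr_gt0; first by lra.
have : 0 <= P * (Q * (Q - 1) - 2) by apply: mulr_ge0; nra.
by lra.
Qed.

(** The ratio of the left side to [n,t+1] is about 1/(q^2 (q - 1)), at most 1/4; with one more
    dimension missing, as in the next lemma, it is about 1/(q^3 (q - 1)), at most 1/8. *)
Lemma point_le_quarter n t : (t.*2.+4 <= n)%N ->
  G (n - t.+3) 1 * G n.-1 t <= G n t.+1 / 4.
Proof.
move=> ltn.
have [e1 eQ] := @gauss1_scaled (n - t.+3) n t 2 ltac:(nlia) isT.
have Q2 := q_ge2 q_gt1; have g0 : 0 < G n t.+1 by rewrite gauss_gt0 //; nlia.
have Qn : 0 < Q ^+ n - 1 by rewrite expqB1_gt0 //; nlia.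
have Q1 : 0 < Q - 1 by lra.
have a1 := expq_ge1 q_gt1 t.+1; have P1 := expq_ge1 q_gt1 (n - t.+3).
rewrite -(ler_pM2r Qn) -(ler_pM2r Q1) e1 eQ.
move: (Q ^+ t.+1) (Q ^+ (n - t.+3)) a1 P1 => a P a1 P1.
have -> : G n t.+1 / 4 * (a * P * Q ^+ 2 - 1) * (Q - 1)
  = ((a * P * Q ^+ 2 - 1) * (Q - 1) / 4) * G n t.+1 by field.
rewrite ler_pM2r //; have aP : 1 <= a * P by nra.
have : 4 <= Q ^+ 2 * (Q - 1) by rewrite expr2; nra.
have : Q - 1 <= (Q ^+ 2 * (Q - 1)) / 4 by rewrite expr2; nra.
set z := Q ^+ 2 * (Q - 1) => le1 le2.
have -> : (a * P * Q ^+ 2 - 1) * (Q - 1) = a * P * z - (Q - 1) by rewrite /z; ring.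
by nra.
Qed.

Lemma point_le_eighth n t : (t.*2.+4 < n)%N ->
  G (n - t.+4) 1 * G n.-1 t <= G n t.+1 / 8.
Proof.
move=> ltn.
have [e1 eQ] := @gauss1_scaled (n - t.+4) n t 3 ltac:(nlia) isT.
have Q2 := q_ge2 q_gt1; have g0 : 0 < G n t.+1 by rewrite gauss_gt0 //; nlia.
have Qn : 0 < Q ^+ n - 1 by rewrite expqB1_gt0 //; nlia.
have Q1 : 0 < Q - 1 by lra.
have a1 := expq_ge1 q_gt1 t.+1; have P1 := expq_ge1 q_gt1 (n - t.+4).
rewrite -(ler_pM2r Qn) -(ler_pM2r Q1) e1 eQ.
move: (Q ^+ t.+1) (Q ^+ (n - t.+4)) a1 P1 => a P a1 P1.
have -> : G n t.+1 / 8 * (a * P * Q ^+ 3 - 1) * (Q - 1)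
  = ((a * P * Q ^+ 3 - 1) * (Q - 1) / 8) * G n t.+1 by field.
rewrite ler_pM2r //; have aP : 1 <= a * P by nra.
have Q4 : 4 <= Q ^+ 2 by rewrite expr2; nra.
have : 8 <= Q ^+ 3 * (Q - 1) by rewrite exprS; nra.
have : Q - 1 <= (Q ^+ 3 * (Q - 1)) / 8 by rewrite exprS; nra.
set z := Q ^+ 3 * (Q - 1) => le1 le2.
have -> : (a * P * Q ^+ 3 - 1) * (Q - 1) = a * P * z - (Q - 1) by rewrite /z; ring.
by nra.
Qed.

(** The quotient of the two binomials is below q^-(t+1), which t > 0 makes at most 1/4. *)
Lemma gauss_pred_lt_quarter n t : (0 < t)%N -> (t.+1 < n)%N ->
  G n.-1 t.+1 < G n t.+1 / 4.
Proof.
move=> t0 ltn; have [e2 _] := @gauss_pred_scaled n t ltac:(nlia).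
have Q2 := q_ge2 q_gt1; have g0 : 0 < G n t.+1 by rewrite gauss_gt0 //; nlia.
have Qn : 0 < Q ^+ n - 1 by rewrite expqB1_gt0 //; nlia.
rewrite -(ltr_pM2r Qn) e2.
have -> : Q ^+ n = Q ^+ t.+1 * Q ^+ (n - t.+1) by rewrite -exprD; congr (_ ^+ _); nlia.
have c1 := expq_ge1 q_gt1 (n - t.+1).
have a4 : 4 <= Q ^+ t.+1.
  have : Q ^+ 2 <= Q ^+ t.+1 by rewrite ler_weXn2l // (ler_nat _ 1) ltnW.
  by rewrite expr2; nra.
move: (Q ^+ t.+1) (Q ^+ (n - t.+1)) a4 c1 => a c a4 c1.
have -> : G n t.+1 / 4 * (a * c - 1) = G n t.+1 * ((a * c - 1) / 4) by field.
rewrite ltr_pM2l //; nra.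
Qed.

End Estimates.

(** 4/35 = x^2 / (1 - x). The strengthened statement adds the remainder 7/5 x^(N-t) of the series,
    which makes both sides equal. *)
Lemma geometric_tail (x : rat) t N : x = 2 / 7 -> (t.+2 <= N)%N ->
  \sum_(t.+2 <= k < N) x ^+ (k - t) <= 4 / 35.
Proof.
move=> def_x leN; have x0 : 0 <= x by lra.
suff : \sum_(t.+2 <= k < N) x ^+ (k - t) + 7 / 5 * x ^+ (N - t) <= 4 / 35.
  by have := exprn_ge0 (N - t) x0; lra.
rewrite -(subnKC leN); elim: (N - _)%N => [|j IH].
  rewrite addn0 big_geq; last exact: leqnn.
  have -> : (t.+2 - t = 2)%N by nlia.
  by rewrite expr2 def_x; lra.
rewrite addnS big_nat_recr /=; last exact: leq_addr.
rewrite subSn; last by nlia.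
by rewrite exprS def_x in IH *; lra.
Qed.

Lemma sum_ends (g : nat -> rat) n t : (t.*2 < n)%N ->
  \sum_(0 <= k < n.+1) g k
    = \sum_(i < t.+1) (g i + g (n - i)%N) + \sum_(t.+1 <= k < n - t) g k.
Proof.
elim: t => [|t IH] lt2t.
  by rewrite big_ord1 subn0 big_ltn // big_nat_recr //= addrAC addrA.
rewrite IH; last by nlia.
rewrite [in RHS]big_ord_recr /= -[RHS]addrA; congr (_ + _).
have -> : (n - t = (n - t.+1).+1)%N by nlia.
rewrite big_nat_recr /=; last by nlia.
have [lt1|] := ltnP t.+1 (n - t.+1); last by nlia.
by rewrite big_ltn //= addrAC.
Qed.

(** * Families of near-pencils *)

Section Sunflower.
Variables (F : finFieldType) (n : nat).
Local Notation V := 'rV[F]_n.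
Local Notation q := #|F|.
Local Notation G := (gauss_binom q).
Local Notation q1 := (card_field_gt1 F).
Implicit Types (A B C D E T X Y : {vspace V}) (S : {set {vspace V}}).

(** Two members A and B fix D, their intersection, and T, their sum. A member not containing D meets
    A and B in distinct hyperplanes of itself, so it lies in T. If such a C exists, a member E
    through D is spanned by D and [E :&: C], so it lies in T as well. *)
Lemma sunflower_or_ball S k : (0 < k)%N -> S \subset subspaces F n k ->
  intersecting k.-1 S -> S != set0 ->
  (exists2 D, \dim D = k.-1 & forall A, A \in S -> (D <= A)%VS)
  \/ (exists2 T, \dim T = k.+1 & forall A, A \in S -> (A <= T)%VS).
Proof.
move=> k0 sS iS /set0Pn[A AS].
have dS C : C \in S -> \dim C = k.
  by move=> CS; apply/eqP; rewrite -in_subspaces (subsetP sS).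
have dcap C C' : C \in S -> C' \in S -> C != C' -> \dim (C :&: C') = k.-1.
  move=> CS CS' neqC; have := iS _ _ CS CS'.
  have : \dim (C :&: C') != k.
    apply: contra neqC => /eqP dCC; apply/eqP.
    have e1 : (C :&: C')%VS = C by apply: eq_sub_dim; rewrite ?capvSl // dCC (dS C CS).
    have e2 : (C :&: C')%VS = C' by apply: eq_sub_dim; rewrite ?capvSr // dCC (dS C' CS').
    by rewrite -{1}e1 e2.
  by have := dimvS (capvSl C C'); rewrite (dS C CS); nlia.
have [/existsP[B /andP[BS neqB]]|] := boolP [exists B, (B \in S) && (A != B)]; last first.
  move/existsPn => allA; left.
  have [|D [_ sDA dD]] := btw_ex (k := k.-1) (sub0v A); first by rewrite dimv0 dS //; nlia.
  exists D => // B BS; have := allA B; rewrite BS negbK => /eqP <-.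
  exact: sDA.
pose D := (A :&: B)%VS; pose T := (A + B)%VS.
have dD : \dim D = k.-1 by apply: dcap.
have dT : \dim T = k.+1.
  by have := dimv_sum_cap A B; rewrite -/D -/T dD (dS A AS) (dS B BS); nlia.
have [|] := boolP [exists C, (C \in S) && ~~ (D <= C)%VS]; last first.
  by move/existsPn => allD; left; exists D => // C CS; have := allD C; rewrite CS negbK.
case/existsP => C /andP[CS nDC]; right; exists T => //.
have span C1 X Y : C1 \in S -> (X <= C1)%VS -> (Y <= C1)%VS -> (X <= T)%VS ->
    (Y <= T)%VS -> \dim X = k.-1 -> ~~ (X <= Y)%VS -> \dim Y = k.-1 -> (C1 <= T)%VS.
  move=> C1S sX sY sXT sYT dX nXY dY.
  have lt1 : (k.-1 < \dim (X + Y))%N.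
    rewrite -dY ltn_neqAle dimvS ?addvSr // andbT; apply: contra nXY => /eqP dXY.
    by rewrite (eq_sub_dim (addvSr X Y)) ?addvSl // dXY.
  rewrite -(eq_sub_dim (_ : X + Y <= C1)%VS) ?subv_add ?sX ?sXT //.
  by rewrite dS //; move: lt1 k0; clear; lia.
have notD C1 : C1 \in S -> ~~ (D <= C1)%VS -> (C1 <= T)%VS.
  move=> C1S nD.
  have dA : \dim (C1 :&: A) = k.-1.
    by apply: dcap => //; apply: contraNneq nD => ->; rewrite capvSl.
  have dB : \dim (C1 :&: B) = k.-1.
    by apply: dcap => //; apply: contraNneq nD => ->; rewrite capvSr.
  apply: (span _ (C1 :&: A)%VS (C1 :&: B)%VS); rewrite ?capvSl //.
  - by apply: subv_trans (capvSr _ _) (addvSl _ _).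
  - by apply: subv_trans (capvSr _ _) (addvSr _ _).
  apply: contra nD => sAB.
  rewrite -(eq_sub_dim (_ : C1 :&: A <= D)%VS) ?capvSl // ?dA ?dD //.
  by rewrite subv_cap capvSr (subv_trans sAB) ?capvSr.
move=> E ES; have [sDE|] := boolP (D <= E)%VS; last exact: notD.
have dEC : \dim (E :&: C) = k.-1.
  by apply: dcap => //; apply: contraNneq nDC => <-.
apply: (span _ D (E :&: C)%VS) => //.
- by rewrite capvSl.
- by apply: subv_trans (capvSl _ _) (addvSl _ _).
- by apply: subv_trans (capvSr _ _) (notD _ CS nDC).
by apply: contra nDC => /subv_trans; apply; rewrite capvSr.
Qed.

(** A common (k-1)-space leaves the points of Y modulo it, a common (k+1)-space leaves its
    hyperplanes through X. The interval serves layers whose members all contain, or all lie in, a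
    member of another layer. *)
Lemma sunflower_or_ball_bound S X Y k : (0 < k)%N -> S \subset btw X Y k ->
  intersecting k.-1 S ->
  #|S|%:R <= Order.max (G (\dim Y - k.-1) 1) (G (k.+1 - \dim X) 1).
Proof.
move=> k0 sS iS; have [->|[A0 A0S]] := set_0Vmem S.
  by rewrite cards0 le_max gauss_ge0 ?q1.
have := subsetP sS _ A0S; rewrite in_btw => /and3P[sXA0 sA0Y /eqP dA0].
have dX : (\dim X <= k)%N by rewrite -dA0 dimvS.
have [||[D dD allD]|[T dT allT]] := @sunflower_or_ball S k k0 _ iS.
- by apply/subsetP => A /(subsetP sS); rewrite in_btw in_subspaces => /and3P[].
- by apply/set0Pn; exists A0.
- apply: (@le_trans _ _ #|btw D Y k|%:R).
    rewrite ler_nat; apply/subset_leq_card/subsetP => A AS.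
    by have := subsetP sS _ AS; rewrite !in_btw allD // => /and3P[_ -> ->].
  have sDY : (D <= Y)%VS by apply: subv_trans (allD _ A0S) _.
  rewrite card_btw ?dD //; last by nlia.
  by rewrite (_ : k - k.-1 = 1)%N ?le_max ?lexx //; nlia.
apply: (@le_trans _ _ #|btw X T k|%:R).
  rewrite ler_nat; apply/subset_leq_card/subsetP => A AS.
  by have := subsetP sS _ AS; rewrite !in_btw allT // => /and3P[-> _ ->].
have sXT : (X <= T)%VS by apply: subv_trans sXA0 (allT _ A0S).
rewrite card_btw // dT -gauss_sym ?q1 ?leq_sub2r //.
by rewrite (_ : k.+1 - \dim X - (k - \dim X) = 1)%N ?le_max ?lexx ?orbT //; nlia.
Qed.

End Sunflower.

(** * The middle layers *)

Section Middle.
Variables (F : finFieldType) (n d : nat) (b : {biscalar 'rV[F]_n}).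
Hypothesis nondeg : nondegenerate_form b.
Variable fam : {set {vspace 'rV[F]_n}}.
Hypothesis cl : close d fam.
Local Notation V := 'rV[F]_n.
Local Notation q := #|F|.
Local Notation G := (gauss_binom q).
Local Notation q1 := (card_field_gt1 F).
Local Notation f k := (#|layer fam k|%:R : rat).
Implicit Types (A B U W X : {vspace V}).

Let cl' : close d (perp_family b fam) := close_perp nondeg cl.

Let layer_dual k : (k <= n)%N -> f (n - k) = #|layer (perp_family b fam) k|%:R.
Proof. by move=> lekn; rewrite card_layer_perp. Qed.

Lemma layer_eq0 k : (forall A, A \in fam -> \dim A != k) -> f k = 0.
Proof.
move=> noA; rewrite (_ : layer fam k = set0) ?cards0 //; apply/setP => A.
by rewrite in_layer inE; apply/negP => /andP[/noA/negPf ->].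
Qed.

Lemma layer_neq0 k : f k != 0 -> exists2 A, A \in fam & \dim A = k.
Proof.
have [/existsP[A /andP[AF /eqP dA]]|/existsPn noA] :=
  boolP [exists A in fam, \dim A == k]; first by exists A.
rewrite layer_eq0 ?eqxx // => A AF.
by have := noA A; rewrite AF.
Qed.

Let dim_dual B : B \in fam ->
  exists2 B', B' \in perp_family b fam & \dim B' = (n - \dim B)%N.
Proof. by move=> BF; exists (perp b B); rewrite ?dim_perp //; apply: imset_f. Qed.

Lemma lo_point B k m : B \in fam -> (d < k.+1 + \dim B)%N -> (\dim B <= m)%N ->
  f k.+1 <= G m 1 * G n.-1 k.
Proof.
move=> BF ltd leB; apply: le_trans (layer_point cl BF ltd) _.
by rewrite ler_wpM2r ?gauss_ge0 ?gauss1_le ?q1.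
Qed.

Lemma hi_point B k m : B \in fam -> (k < n)%N -> (d < k.+1 + (n - \dim B))%N ->
  (n - \dim B <= m)%N -> f (n - k.+1) <= G m 1 * G n.-1 k.
Proof.
move=> /dim_dual[B' BF <-] ltk ltd leB; rewrite layer_dual //.
apply: le_trans (layer_point cl' BF ltd) _.
by rewrite ler_wpM2r ?gauss_ge0 ?gauss1_le ?q1.
Qed.

Lemma hi_ekr t : (d <= t.*2.+1)%N -> (t.+1.*2 <= n)%N -> f (n - t.+1) <= G n.-1 t.
Proof.
move=> led le2t; rewrite layer_dual; last by nlia.
exact: layer_ekr cl' _ led le2t.
Qed.

(** A layer is bounded by its code, or by that of the perp family if k > n - k. Adding both powers
    for every k avoids splitting the sum; the two tails are equal by reversal, which gives twice
    4/35. *)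
Lemma mid_sum_le t : (d <= t.*2.+1)%N -> (1 < t)%N -> (t.+1.*2 < n)%N ->
  \sum_(t.+2 <= k < n - t.+1) f k <= 8 / 35 * G n t.
Proof.
move=> led t1 lt2t; have [x def_x] : exists x : rat, x = 2 / 7 by exists (2 / 7).
have x0 : 0 <= x by lra.
have g0 := gauss_ge0 q1 n t.
apply: (@le_trans _ _ (\sum_(t.+2 <= k < n - t.+1) (x ^+ (k - t) + x ^+ (n - k - t)) * G n t)).
  rewrite !big_nat; apply: ler_sum => k /andP[lek ltk].
  have [lekn|gtkn] := leqP k (n - k).
    apply: le_trans (layer_code cl led t1 _ lekn) _; first by nlia.
    by rewrite -def_x ler_wpM2r // lerDl exprn_ge0.
  have -> : f k = #|layer (perp_family b fam) (n - k)|%:R.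
    by rewrite -layer_dual ?leq_subr // subKn //; nlia.
  apply: le_trans (layer_code cl' led t1 _ _) _; [nlia|nlia|].
  by rewrite -def_x ler_wpM2r // lerDr exprn_ge0.
rewrite -mulr_suml; apply: ler_wpM2r; first exact: g0.
rewrite big_split /=.
rewrite [X in _ + X]big_nat_rev /= [X in _ + X]big_nat.
rewrite [X in _ + X](eq_bigr (fun k => x ^+ (k - t))) => [|k /andP[lek ltk]]; last first.
  by congr (_ ^+ _); nlia.
rewrite -[X in _ + X]big_nat.
have := @geometric_tail x t (n - t.+1) def_x; have -> : (t.+2 <= n - t.+1)%N by nlia.
by move=> /(_ isT); lra.
Qed.

(** The outer pairs i < t cost at most [n,i] each, so a strict bound on this part by the remaining
    terms of [diam_bound] makes the whole bound strict. *)
Definition core t := f t + f (n - t) + \sum_(t.+1 <= k < n - t) f k.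

Lemma core_split t : (t.+1.*2 < n)%N -> core t =
  f t + f (n - t) + (f t.+1 + f (n - t.+1) + \sum_(t.+2 <= k < n - t.+1) f k).
Proof.
move=> lt2t; rewrite /core (_ : n - t = (n - t.+1).+1)%N; last by nlia.
rewrite big_nat_recr /=; last by nlia.
by rewrite big_ltn; [rewrite addrAC | nlia].
Qed.

Lemma mid_sum0 t : (forall A, A \in fam -> ~~ (t.+2 <= \dim A < n - t.+1)%N) ->
  \sum_(t.+2 <= k < n - t.+1) f k = 0.
Proof.
move=> noA; rewrite big_nat big1 // => k ltk; apply: layer_eq0 => A AF.
by apply: contraNneq (noA A AF) => ->.
Qed.

(** * Strict bounds on the core from points and codes *)

Section LargeT.
Variable s : nat.
Local Notation t := s.+1.
Local Notation g := (G n t).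
Local Notation h := (G n.-1 t).

Let mid := [exists A in fam, (t.+2 <= \dim A < n - t.+1)%N].

(** A member A with t + 2 <= dim A <= n - t - 2 meets all t-dimensional members and has at most
    [n-t-2,1] points; dually for the layer n - t. *)
Let mid_quarter : (d <= t.*2.+1)%N -> (t.+1.*2 < n)%N -> mid ->
  f t <= g / 4 /\ f (n - t) <= g / 4.
Proof.
move=> led lt2t /exists_inP[A AF /andP[leA ltA]]; split.
  apply: le_trans (point_le_quarter q1 (_ : s.*2.+4 <= n)%N); last by nlia.
  by apply: lo_point AF _ _; nlia.
apply: le_trans (point_le_quarter q1 (_ : s.*2.+4 <= n)%N); last by nlia.
by apply: hi_point AF _ _ _; nlia.
Qed.

Let no_mid : ~~ mid -> forall A, A \in fam -> ~~ (t.+2 <= \dim A < n - t.+1)%N.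
Proof. by move=> /existsPn noA A AF; have := noA A; rewrite AF. Qed.

(** B limits the layer t and B' the layer n - t. With a member as in [mid] the total is at most g/4
    + g/4 + 2h + 8g/35, where h < g/4; this uses the code bound, whence the first hypothesis.
    Without one, only t + 1 and n - t - 1 remain in the middle, at most h each, and [two_points_lt]
    decides. *)
Lemma core_odd_lt B B' : (0 < s)%N || ~~ mid -> d = t.*2.+1 -> (t.*2.+3 <= n)%N ->
  B \in fam -> (t.+2 <= \dim B < n - t)%N ->
  B' \in fam -> (t < \dim B' < n - t.+1)%N -> core t < g + h.
Proof.
move=> s0 def_d len BF dB B'F dB'; rewrite core_split; last by nlia.
have g0 : 0 <= g by exact: gauss_ge0 q1 _ _.
have h0 : 0 <= h by exact: gauss_ge0 q1 _ _.
have e1 : f t.+1 <= h by apply: layer_ekr cl _ _ _; nlia.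
have e2 : f (n - t.+1) <= h by apply: hi_ekr; nlia.
have [em|nm] := boolP mid.
  have t1 : (1 < t)%N by move: s0; rewrite em orbF.
  have [q_lo q_hi] := mid_quarter ltac:(nlia) ltac:(nlia) em.
  have ms := @mid_sum_le t ltac:(nlia) t1 ltac:(nlia).
  have := gauss_pred_lt_quarter q1 (_ : 0 < s)%N (_ : s.+1 < n)%N.
  move=> /(_ t1 ltac:(nlia)); lra.
rewrite (mid_sum0 (no_mid nm)).
have lo : f t <= G (n - s.+2) 1 * G n.-1 s by apply: lo_point BF _ _; nlia.
have hi : f (n - t) <= G (n - s.+2) 1 * G n.-1 s by apply: hi_point B'F _ _ _; nlia.
by have := two_points_lt q1 (_ : s.*2.+3 <= n)%N => /(_ ltac:(nlia)); lra.
Qed.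

Lemma core_even_lt B : (0 < s)%N -> d = t.*2 -> (t.*2.+2 <= n)%N ->
  B \in fam -> (t < \dim B < n - t)%N -> core t < g.
Proof.
move=> s0 def_d len BF dB.
have g0 : 0 <= g by exact: gauss_ge0 q1 _ _.
have h0 : 0 <= h by exact: gauss_ge0 q1 _ _.
have e1 : f t.+1 <= h by apply: layer_ekr cl _ _ _; nlia.
have e2 : f (n - t.+1) <= h by apply: hi_ekr; nlia.
have lo : f t <= G (n - s.+2) 1 * G n.-1 s by apply: lo_point BF _ _; nlia.
have hi : f (n - t) <= G (n - s.+2) 1 * G n.-1 s by apply: hi_point BF _ _ _; nlia.
have two := two_points_lt q1 (_ : s.*2.+3 <= n)%N; move/(_ ltac:(nlia)) in two.
have hq := gauss_pred_lt_quarter q1 s0 (_ : s.+1 < n)%N; move/(_ ltac:(nlia)) in hq.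
(* For n = 2t + 2 there is a single middle layer t + 1 = n - t - 1, which [core_split] would count
   twice. *)
have [def_n|ltn] := leqP n t.*2.+2.
  rewrite /core (_ : n - t = t.+2)%N ?big_nat1; last by nlia.
  rewrite (_ : t.+2 = n - t)%N; last by nlia.
  by lra.
rewrite core_split; last by nlia.
have [em|nm] := boolP mid.
  have [q_lo q_hi] := mid_quarter ltac:(nlia) ltac:(nlia) em.
  have ms := @mid_sum_le t ltac:(nlia) ltac:(nlia) ltac:(nlia).
  (* If one of the layers t + 1 and n - t - 1 is empty, 1/4 + 1/4 + 8/35 + 1/4 < 1 suffices. If both
     have members, A1 has few points and A2 small codimension, so the layers t and n - t shrink to
     g/8 each, and 1/8 + 1/8 + 8/35 + 1/4 + 1/4 < 1. *)
  have [z1|/layer_neq0[A1 A1F dA1]] := eqVneq (f t.+1) 0; first by lra.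
  have [z2|/layer_neq0[A2 A2F dA2]] := eqVneq (f (n - t.+1)) 0; first by lra.
  have [A /andP[AF /andP[leA ltA]]] := existsP em.
  have p8 := point_le_eighth q1 (_ : s.*2.+4 < n)%N; move/(_ ltac:(nlia)) in p8.
  have lo8 : f t <= G (n - s.+4) 1 * G n.-1 s by apply: lo_point A1F _ _; nlia.
  have hi8 : f (n - t) <= G (n - s.+4) 1 * G n.-1 s by apply: hi_point A2F _ _ _; nlia.
  by lra.
rewrite (mid_sum0 (no_mid nm)).
have [z1|/layer_neq0[A1 A1F dA1]] := eqVneq (f t.+1) 0; first by lra.
have [z2|/layer_neq0[A2 A2F dA2]] := eqVneq (f (n - t.+1)) 0; first by lra.
have p4 := point_le_quarter q1 (_ : s.*2.+4 <= n)%N; move/(_ ltac:(nlia)) in p4.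
have lo4 : f t <= G (n - s.+3) 1 * G n.-1 s by apply: lo_point A1F _ _; nlia.
have hi4 : f (n - t) <= G (n - s.+3) 1 * G n.-1 s by apply: hi_point A2F _ _ _; nlia.
by lra.
Qed.

End LargeT.
End Middle.

(** * Strict bounds on the core for d = 2 and d = 3 *)

Section SmallDiameter.
Variables (F : finFieldType) (n d : nat) (b : {biscalar 'rV[F]_n}).
Hypothesis nondeg : nondegenerate_form b.
Variable fam : {set {vspace 'rV[F]_n}}.
Hypothesis cl : close d fam.
Local Notation V := 'rV[F]_n.
Local Notation q := #|F|.
Local Notation G := (gauss_binom q).
Local Notation q1 := (card_field_gt1 F).
Local Notation f k := (#|layer fam k|%:R : rat).
Implicit Types (A B C U W X : {vspace V}).

Lemma sum_window (g : nat -> rat) m1 m2 c1 c2 : (m1 <= c1)%N -> (c1 <= c2)%N -> (c2 <= m2)%N ->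
  (forall k, (m1 <= k < m2)%N -> ~~ (c1 <= k < c2)%N -> g k = 0) ->
  \sum_(m1 <= k < m2) g k = \sum_(c1 <= k < c2) g k.
Proof.
move=> le1 le2 le3 g0; rewrite (big_cat_nat (n := c1)) //=; last exact: leq_trans le3.
rewrite [X in _ + X](big_cat_nat (n := c2)) //= big_nat big1 ?add0r; last first.
  by move=> k hk; apply: g0; move: hk le2 le3; clear; lia.
rewrite [X in _ + X]big_nat [X in _ + X]big1 ?addr0 // => k hk.
by apply: g0; move: hk le1 le2; clear; lia.
Qed.

Lemma layer_sunflower k X Y : (d <= 3)%N -> (1 < k)%N -> layer fam k \subset btw X Y k ->
  f k <= Order.max (G (\dim Y - k.-1) 1) (G (k.+1 - \dim X) 1).
Proof.
move=> d3 k1 sk; apply: sunflower_or_ball_bound => //; first by nlia.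
by rewrite -subn1; exact: (@layer_intersecting _ _ _ _ cl 1 k d3 k1).
Qed.

Lemma layer_le_mid k : (d <= 3)%N -> (2 < k < n - 2)%N -> f k <= G (n - 2) 1.
Proof.
move=> d3 hk; have := @layer_sunflower k 0%VS {:V}%VS d3 ltac:(nlia).
rewrite -subspacesE layer_sub => /(_ isT)/le_trans; apply.
by rewrite ge_max dim_rV dimv0 !gauss1_le ?q1 //; nlia.
Qed.

(** The smallest positive dimension c of a member confines the others of positive dimension to c,
    ..., c + 3, so at most four layers count. Each has at most H = [n-2,1] members, except that 2
    and n - 2 may reach [n-1,1] = H + de. The total is at most 4H + 2de = 2[n-2,1] + 2[n-1,1], and
    [gauss1_double] concludes. *)
Lemma core_odd_one_lt A0 : d = 3%N -> A0 \in fam -> (2 < \dim A0 < n - 2)%N ->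
  core fam 1 < G n 1 + G n.-1 1.
Proof.
move=> d3 A0F dA0; have n6 : (5 < n)%N by nlia.
have [H def_H] : exists H, H = G (n - 2) 1 by exists (G (n - 2) 1).
have [de def_de] : exists de, de = G n.-1 1 - H by exists (G n.-1 1 - H).
have H0 : 0 <= H by rewrite def_H; exact: gauss_ge0 q1 _ _.
have de0 : 0 <= de by rewrite def_de def_H subr_ge0 gauss1_le ?q1 //; nlia.
have -> : core fam 1 = \sum_(1 <= k < n) f k.
  rewrite /core [RHS]big_ltn; last by nlia.
  rewrite [X in _ = _ + \sum_(_ <= k < X) _](_ : n = (n - 1).+1)%N; last by nlia.
  by rewrite [in RHS]big_nat_recr /=; [ring | nlia].
have [A1 /andP[A1F dA1] minA1] : exists2 A, (A \in fam) && (0 < \dim A)%N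
    & forall B, (B \in fam) && (0 < \dim B)%N -> (\dim A <= \dim B)%N.
  pose P A := (A \in fam) && (0 < \dim A)%N.
  have P0 : P A0 by rewrite /P A0F; nlia.
  by case: (arg_minnP (fun A => \dim A) P0) => A hA minA; exists A.
set c := \dim A1 in dA1 minA1.
have cA0 : (c <= \dim A0)%N by apply: minA1; rewrite A0F; nlia.
have cn : (c < n)%N by nlia.
have wl : (c <= minn n c.+4)%N by nlia.
rewrite (sum_window dA1 wl (geq_minl _ _)); last first.
  move=> k hk nk; apply: layer_eq0 => B BF; apply: contraNneq nk => dB.
  have := minA1 B; rewrite BF dB (proj1 (andP hk)) => /(_ isT) lec.
  have := cl A1F BF; rewrite -/c dB d3; have := dimvS (capvSl A1 B); rewrite -/c.
  by move: hk lec; clear; lia.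
have [i1 def_i] : exists i1 : nat -> nat -> rat, forall i k, i1 i k = if k == i then de else 0.
  by exists (fun i k => if k == i then de else 0).
have i0 i k : 0 <= i1 i k by rewrite def_i; case: ifP.
have iE i : i1 i i = de by rewrite def_i eqxx.
have fk k : (c <= k < minn n c.+4)%N -> f k <= H + (i1 2 k + i1 (n - 2)%N k).
  move=> hk; have hkn : (0 < k < n)%N by move: hk dA1; clear; lia.
  have := i0 2 k; have := i0 (n - 2)%N k.
  have [k1|k1] := eqVneq k 1%N.
    have := lo_point (k := 0) (m := n - 2) cl A0F; rewrite gaussn0 mulr1 k1 -def_H.
    by move=> /(_ ltac:(nlia) ltac:(nlia)); lra.
  have [k2|k2] := eqVneq k 2%N.
    have := layer_ekr cl (t := 1) ltac:(nlia) ltac:(nlia); rewrite k2 iE => le1 h1 h2.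
    by apply: le_trans le1 _; lra.
  have [kn|kn] := eqVneq k (n - 2)%N.
    have := hi_ekr nondeg cl (t := 1) ltac:(nlia) ltac:(nlia); rewrite -kn iE => le1 h1 h2.
    by apply: le_trans le1 _; lra.
  have [kn1|kn1] := eqVneq k (n - 1)%N.
    have := hi_point nondeg (k := 0) (m := n - 2) cl A0F; rewrite gaussn0 mulr1 -kn1 -def_H.
    by move=> /(_ ltac:(nlia) ltac:(nlia) ltac:(nlia)); lra.
  have : f k <= H by rewrite def_H; apply: layer_le_mid; move: hkn k1 k2 kn kn1 d3; clear; lia.
  by lra.
apply: (@le_lt_trans _ _ (4 * H + (de + de))); last first.
  have := gauss1_double q1 (n - 2); have := gauss1_double q1 n.-1; rewrite -def_H.
  have -> : (n - 2).+1 = n.-1 by nlia.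
  have -> : n.-1.+1 = n by nlia.
  by lra.
rewrite big_nat; apply: le_trans (ler_sum _ fk) _; rewrite -big_nat !big_split /=.
have sum_if i : \sum_(c <= k < minn n c.+4) i1 i k <= de.
  rewrite (eq_bigr _ (fun k _ => def_i i k)) -big_mkcond big_nat1_eq.
  by case: ifP => _; [exact: lexx | exact: de0].
apply: lerD; last by apply: lerD; apply: sum_if.
rewrite sumr_const_nat -[_ *+ (_ - _)]mulr_natl; apply: ler_wpM2r; first exact: H0.
by rewrite (ler_nat _ _ 4); move: cn; clear; lia.
Qed.

(** The extreme dimensions dim A <= dim C of members between 2 and n - 2 differ by at most 2. If
    they differ, every member of the smaller dimension lies in every member of the larger, which
    confines both layers to intervals. The points of A bound the layer 1, the hyperplanes over C the
    layer n - 1. The differences 0, 1 and 2 are budgeted separately. *)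
Lemma core_even_one_lt B : d = 2%N -> B \in fam -> (1 < \dim B < n - 1)%N ->
  core fam 1 < G n 1.
Proof.
move=> d2 BF dB.
pose P A := (A \in fam) && (1 < \dim A < n - 1)%N.
have PB : P B by rewrite /P BF.
have [A /andP[AF dA] minA] : exists2 A, P A & forall C, P C -> (\dim A <= \dim C)%N.
  by case: (arg_minnP (fun A => \dim A) PB) => A hA minA; exists A.
have [C /andP[CF dC] maxC] : exists2 C, P C & forall E, P E -> (\dim E <= \dim C)%N.
  by case: (arg_maxnP (fun A => \dim A) PB) => C hC maxC; exists C => // E /maxC.
have leAC : (\dim A <= \dim C)%N by apply: maxC; rewrite /P AF.
have capAC : (\dim (A :&: C) <= \dim A)%N by rewrite dimvS ?capvSl.
have := cl AF CF; rewrite d2 => clAC.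
have leC : (\dim C <= (\dim A).+2)%N by move: clAC capAC; clear; lia.
have u1 := gauss1_double q1 (n - 3); have v1 := gauss1_double q1 (n - 2).
have w1 := gauss1_double q1 n.-1; have u0 := gauss_ge0 q1 (n - 3) 1.
move: u1 v1 w1; have -> : (n - 3).+1 = (n - 2)%N by nlia.
have -> : (n - 2).+1 = n.-1 by nlia.
have -> : n.-1.+1 = n by nlia.
move=> u1 v1 w1; rewrite /core.
rewrite (@sum_window _ 2 (n - 1) (\dim A) (\dim C).+1); [|by nlia..|]; last first.
  move=> k hk nk; apply: layer_eq0 => E EF; apply: contraNneq nk => dE.
  have PE : P E by rewrite /P EF dE.
  by have := minA _ PE; have := maxC _ PE; rewrite dE; clear; lia.
have gle m m' : (m <= m')%N -> G m 1 <= G m' 1 by apply: gauss1_le q1 _ _.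
have lo m : (\dim A <= m)%N -> f 1 <= G m 1.
  by move=> lem; have := lo_point (k := 0) (m := m) cl AF; rewrite gaussn0 mulr1; apply; nlia.
have hi m : (n - \dim C <= m)%N -> f (n - 1) <= G m 1.
  move=> lem; have := hi_point nondeg (k := 0) (m := m) cl CF; rewrite gaussn0 mulr1.
  by apply; [nlia | move: d2 dC; clear; lia | exact: lem].
have [eqAC|neqAC] := eqVneq (\dim A) (\dim C).
  rewrite eqAC big_nat1.
  have fC : f (\dim C) <= G n.-1 1.
    have [c2|c2] := eqVneq (\dim C) 2%N; first by rewrite c2; apply: layer_ekr cl _ _ _; nlia.
    have [cn|cn] := eqVneq (\dim C) (n - 2)%N.
      by rewrite cn; apply: (hi_ekr nondeg cl); nlia.
    apply: le_trans (layer_le_mid _ _) (gle _ _ _); [by nlia| |by nlia].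
    by move: dC c2 cn; clear; lia.
  have := lo (n - 2)%N ltac:(nlia); have := hi (n - 2)%N ltac:(nlia).
  have := two_points_lt q1 (t := 0) (n := n) ltac:(nlia); rewrite gaussn0 mulr1.
  by lra.
have cont E E' : E \in fam -> E' \in fam -> \dim E = \dim A -> \dim E' = \dim C ->
    (E <= E')%VS.
  move=> EF EF' dE dE'; have := cl EF EF'; rewrite d2 dE dE' => clE.
  have := dimvS (capvSl E E'); rewrite dE => leE.
  rewrite -(eq_sub_dim (capvSl E E')) ?capvSr // dE.
  by move: neqAC leAC clE leE; clear; lia.
have fA : f (\dim A) <= G (\dim A).+1 1.
  have := @layer_sunflower (\dim A) 0%VS C ltac:(nlia) ltac:(nlia).
  have -> : layer fam (\dim A) \subset btw 0 C (\dim A).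
    apply/subsetP => E; rewrite in_layer in_btw sub0v => /andP[EF /eqP dE].
    by rewrite dE eqxx (cont E C).
  move=> /(_ isT)/le_trans; apply.
  by rewrite ge_max dimv0 subn0 lexx andbT gle //; nlia.
have fC : f (\dim C) <= G (n - \dim C).+1 1.
  have := @layer_sunflower (\dim C) A {:V}%VS ltac:(nlia) ltac:(nlia).
  have -> : layer fam (\dim C) \subset btw A {:V}%VS (\dim C).
    apply/subsetP => E; rewrite in_layer in_btw subvf => /andP[EF /eqP dE].
    by rewrite dE eqxx (cont A E).
  move=> /(_ isT)/le_trans; apply.
  by rewrite ge_max dim_rV !gle //; nlia.
have lt_AC : (\dim A < \dim C)%N by rewrite ltn_neqAle neqAC.
have := lo (n - 3)%N ltac:(nlia); have := hi (n - 3)%N ltac:(nlia).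
have [eqC|ltC] := leqP (\dim C) (\dim A).+1.
  have eC : \dim C = (\dim A).+1 by nlia.
  rewrite eC big_ltn ?big_nat1 -?eC; last by nlia.
  have := gle (\dim A).+1 (n - 2)%N ltac:(nlia).
  have := gle (n - \dim C).+1 (n - 2)%N ltac:(nlia).
  by lra.
have eC : \dim C = (\dim A).+2 by nlia.
have -> : \sum_(\dim A <= k < (\dim C).+1) f k
    = f (\dim A) + (f (\dim A).+1 + f (\dim C)).
  rewrite big_ltn; last by nlia.
  rewrite big_ltn; last by nlia.
  by rewrite eC big_nat1.
have := gle (\dim A).+1 (n - 3)%N ltac:(nlia).
have := gle (n - \dim C).+1 (n - 3)%N ltac:(nlia).
have := @layer_le_mid (\dim A).+1 ltac:(nlia) ltac:(nlia).
by lra.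
Qed.

End SmallDiameter.

(** * Extremal families *)

Section Extremal.
Variables (F : finFieldType) (n d : nat).
Local Notation V := 'rV[F]_n.
Local Notation q := #|F|.
Local Notation G := (gauss_binom q).
Local Notation q1 := (card_field_gt1 F).
Local Notation f fam k := (#|layer fam k|%:R : rat).
Implicit Types (A B U W X : {vspace V}) (fam : {set {vspace V}}).

Lemma diam_bound_even t : d = (2 * t)%N ->
  diam_bound F n d = \sum_(i < t.+1) G n i.
Proof. by rewrite /diam_bound mul2n => ->; rewrite doubleK odd_double addr0. Qed.

Lemma diam_bound_odd t : d = (2 * t).+1 ->
  diam_bound F n d = \sum_(i < t.+1) G n i + G n.-1 t.
Proof. by rewrite /diam_bound mul2n => ->; rewrite /= uphalf_double odd_double. Qed.

Lemma card_fam_ends fam t : (t.*2 < n)%N ->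
  #|fam|%:R = \sum_(i < t.+1) (f fam i + f fam (n - i))
              + \sum_(t.+1 <= k < n - t) f fam k :> rat.
Proof. by move=> lt2t; rewrite card_layers (sum_ends (fun k => f fam k) lt2t). Qed.

Lemma one_of_two_sum fam k : one_of_two_layers fam k ->
  f fam k + f fam (n - k) = G n k.
Proof. by case=> -[-> ->]; rewrite ?addr0 ?add0r. Qed.

Lemma sum_tight t (a c : nat -> rat) (x y : rat) :
  (forall i, (i < t)%N -> a i <= c i) -> x <= y ->
  \sum_(i < t) a i + x = \sum_(i < t) c i + y ->
  (forall i, (i < t)%N -> a i = c i) /\ x = y.
Proof.
move=> le_ac le_xy eqs.
have sumge0 : \sum_(i < t) (c i - a i) >= 0.
  by apply: sumr_ge0 => i _; rewrite subr_ge0 le_ac.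
have eqxy : x = y by move: sumge0; rewrite sumrB; lra.
split=> // i lti; apply/esym/eqP; rewrite -subr_eq0; apply/eqP.
have sum0 : \sum_(j < t) (c j - a j) = 0 by rewrite sumrB; lra.
have ge0 (j : 'I_t) : true -> 0 <= c j - a j by rewrite subr_ge0 le_ac.
by have := psumr_eq0P ge0 sum0 => /(_ (Ordinal lti) isT).
Qed.

Lemma sum_low_layers fam t : (t <= n)%N ->
  (forall k, (k <= t)%N -> layer fam k = subspaces F n k) ->
  \sum_(0 <= k < t.+1) f fam k = \sum_(i < t.+1) G n i.
Proof.
move=> letn lo; rewrite big_mkord; apply: eq_bigr => i _.
by rewrite lo ?card_subspaces // -ltnS ltn_ord.
Qed.

(** A count that looks at the shape only, not at the diameter, so it serves the family and its perp
    alike. *)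
Lemma extremal_card fam : extremal d fam -> #|fam|%:R = diam_bound F n d.
Proof.
case=> t [[def_n def_d two]|[def_n def_d two mid _]|[len def_d def_fam]|[len def_d [X dX def_fam]]].
- rewrite (diam_bound_even def_d) (@card_fam_ends fam t); last by nlia.
  rewrite [X in _ + X]big_geq ?addr0; last by nlia.
  by apply: eq_bigr => i _; apply/one_of_two_sum/two; rewrite -ltnS ltn_ord.
- rewrite (diam_bound_odd def_d) (@card_fam_ends fam t); last by nlia.
  have -> : (n - t = t.+2)%N by nlia.
  rewrite big_nat1 mid; congr (_ + _).
  by apply: eq_bigr => i _; apply/one_of_two_sum/two; rewrite -ltnS ltn_ord.
- have inF A : (A \in fam) = (\dim A <= t)%N.
    rewrite def_fam; apply/bigcupP/idP => [[k _]|leA].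
      by rewrite in_subspaces => /eqP ->; rewrite -ltnS.
    by exists (Ordinal (leA : \dim A < t.+1)%N); rewrite ?in_subspaces.
  rewrite (diam_bound_even def_d) card_layers (big_cat_nat (n := t.+1)) //=; last by nlia.
  rewrite (@sum_low_layers fam t); [|by nlia|]; last first.
    move=> k lek; apply/setP => A; rewrite in_layer inF in_subspaces.
    by have [->|] := eqVneq (\dim A) k; rewrite ?lek ?andbF.
  rewrite [X in _ + X]big_nat [X in _ + X]big1 ?addr0 // => k /andP[ltk _].
  apply: layer_eq0 => A; rewrite inF => leA; move: leA ltk; clear; lia.
have inF A : (A \in fam) = (\dim A <= t)%N || ((\dim A == t.+1) && (X <= A)%VS).
  rewrite def_fam in_setU [in X in _ || X]inE in_subspaces; congr (_ || _).
  apply/bigcupP/idP => [[k _]|leA].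
    by rewrite in_subspaces => /eqP ->; rewrite -ltnS.
  by exists (Ordinal (leA : \dim A < t.+1)%N); rewrite ?in_subspaces.
rewrite (diam_bound_odd def_d) card_layers (big_cat_nat (n := t.+1)) //=; last by nlia.
rewrite (@sum_low_layers fam t); [|by nlia|]; last first.
  move=> k lek; apply/setP => A; rewrite in_layer inF in_subspaces.
  by have [->|] := eqVneq (\dim A) k; rewrite ?lek ?andbF.
rewrite big_ltn; last by nlia.
rewrite (_ : layer fam t.+1 = [set A in subspaces F n t.+1 | (X <= A)%VS]).
  rewrite card_star // [X in _ + (_ + X)]big_nat [X in _ + (_ + X)]big1 ?addr0 //.
  move=> k /andP[ltk _]; apply: layer_eq0 => A.
  by rewrite inF => hA; apply/eqP => dA; move: hA; rewrite dA; move: ltk; clear; lia.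
apply/setP => A; rewrite in_layer inF inE in_subspaces.
by case: eqP => [->|]; rewrite ?andbT ?andbF //= ltnn.
Qed.

(** * Structure of families that attain the bound *)

Section Close.
Variable fam : {set {vspace V}}.
Hypothesis cl : close d fam.
Hypothesis ltdn : (d < n)%N.

Lemma pair_one_of_two k : (k <= n)%N -> f fam k + f fam (n - k) = G n k ->
  one_of_two_layers fam k.
Proof.
move=> lekn /(layer_pair_tight cl ltdn lekn)[[e1 e2]|[e1 e2]]; [left|right].
  by rewrite e1 e2 cards0 card_subspaces.
by rewrite e1 e2 cards0 card_subspaces gauss_sym ?q1.
Qed.

Lemma tight_extremal (t : nat) y : (t.*2 < n)%N ->
  \sum_(t.+1 <= k < n - t) f fam k <= y ->
  #|fam|%:R <= \sum_(i < t.+1) G n i + y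
  /\ (#|fam|%:R = \sum_(i < t.+1) G n i + y ->
      (forall i, (i <= t)%N -> f fam i + f fam (n - i) = G n i)
      /\ \sum_(t.+1 <= k < n - t) f fam k = y).
Proof.
move=> lt2t ley.
have pairs i : (i < t.+1)%N -> f fam i + f fam (n - i) <= G n i.
  by move=> lti; apply: layer_pair cl _ _ _; nlia.
rewrite (card_fam_ends fam lt2t); split.
  by apply: lerD ley; apply: ler_sum => i _; apply: pairs.
move/(@sum_tight t.+1 (fun i => f fam i + f fam (n - i)) (fun i => G n i) _ _ pairs ley).
by case.
Qed.

(* An (i+1)-space and an (n-i)-space meeting in a 1-space are at distance n-1. *)
Lemma no_far_pair i A : (d.+2 <= n)%N -> A \in fam -> \dim A = i.+1 ->
  layer fam (n - i) != subspaces F n (n - i).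
Proof.
move=> len AF dA; apply/eqP => full.
have [|U [_ sUA dU]] := btw_ex (k := i) (sub0v A); first by rewrite dimv0 dA /=.
have dW : \dim (U^C)%VS = (n - i)%N by rewrite dimv_compl dim_rV dU.
have WF : (U^C)%VS \in fam.
  have : (U^C)%VS \in layer fam (n - i) by rewrite full in_subspaces dW.
  by rewrite in_layer => /andP[].
have := cl AF WF; have := dimv_sum_cap A U^C.
have -> : (A + U^C = fullv)%VS.
  by apply/eqP; rewrite eqEsubv subvf -(addv_complf U) addvS ?subvv.
have := dim_le A; rewrite dim_rV dW dA; move: len; clear; lia.
Qed.

(** Descent from t to 0: a full layer i + 1 has a member, which by [no_far_pair] keeps the layer n -
    i from being full; equality in the pair then makes the layer i full. *)
Lemma low_layers_full t : (d.+2 <= n)%N -> (t.*2 < n)%N ->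
  (forall i, (i <= t)%N -> f fam i + f fam (n - i) = G n i) ->
  layer fam (n - t) != subspaces F n (n - t) ->
  forall i, (i <= t)%N -> layer fam i = subspaces F n i /\ layer fam (n - i) = set0.
Proof.
move=> len lt2t tight nfull i leit.
rewrite -(subKn leit); elim: (t - i)%N => [|j IH].
  rewrite subn0.
  case: (layer_pair_tight cl ltdn _ (tight t (leqnn t))) => [||[_]]; [by nlia|exact|].
  by move/eqP; rewrite (negPf nfull).
have [ltj|lejt] := ltnP j t; last first.
  have e1 : (t - j = 0)%N by nlia.
  have e2 : (t - j.+1 = 0)%N by nlia.
  by rewrite e1 in IH; rewrite e2; exact: IH.
have [lt1 lt2] : (t - j.+1 <= n)%N /\ (t - j.+1 <= t)%N by split; nlia.
case: (layer_pair_tight cl ltdn lt1 (tight _ lt2)) => [|[_ full]]; first exact.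
have [A [_ _ dA]] : exists A, [/\ (0 <= A)%VS, (A <= {:V})%VS & \dim A = (t - j)%N].
  by apply: btw_ex; rewrite ?sub0v // dimv0 dim_rV; nlia.
have AF : A \in fam.
  have : A \in layer fam (t - j) by rewrite (proj1 IH) in_subspaces dA.
  by rewrite in_layer => /andP[].
have dA' : \dim A = (t - j.+1).+1 by nlia.
by have := no_far_pair len AF dA'; rewrite full eqxx.
Qed.

Lemma extremal_even_low t : (d.+2 <= n)%N -> d = (2 * t)%N ->
  (forall A, A \in fam -> ~~ (t < \dim A < n - t)%N) ->
  (forall i, (i <= t)%N -> f fam i + f fam (n - i) = G n i) ->
  layer fam (n - t) != subspaces F n (n - t) -> extremal3 d t fam.
Proof.
move=> len def_d nomid tight nfull; split=> //.
have lt2t : (t.*2 < n)%N by nlia.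
have lows := low_layers_full len lt2t tight nfull.
apply/setP => A; apply/idP/bigcupP => [AF|[k _ Ak]]; last first.
  have [full _] := lows k (ltn_ord k).
  by move: Ak; rewrite -full in_layer => /andP[].
have [leA|gtA] := leqP (\dim A) t.
  by exists (Ordinal (leA : \dim A < t.+1)%N); rewrite ?in_subspaces.
have := nomid A AF; rewrite gtA /= -leqNgt => leA.
have [|_ empty] := lows (n - \dim A)%N; first by move: leA; clear; lia.
have := in_set0 A; rewrite -empty in_layer AF subKn ?eqxx //.
exact: dim_le.
Qed.

(** Only the layer t + 1 is left in the middle, and equality makes it a star. A member of the star
    keeps the layer n - t from being full, which selects the low alternative in every pair. *)
Lemma odd_low t : (d.+2 <= n)%N -> d = (2 * t).+1 ->
  (forall A, A \in fam -> ~~ (t.+1 < \dim A < n - t)%N) ->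
  #|fam|%:R <= diam_bound F n d
  /\ (#|fam|%:R = diam_bound F n d -> extremal4 d t fam).
Proof.
move=> len def_d nohigh; rewrite (diam_bound_odd def_d).
have sum1 : \sum_(t.+1 <= k < n - t) f fam k = f fam t.+1.
  rewrite big_ltn; last by nlia.
  rewrite big_nat big1 ?addr0 // => k hk; apply: layer_eq0 => A AF.
  by apply: contraNneq (nohigh A AF) => ->.
have ekr : f fam t.+1 <= G n.-1 t by apply: layer_ekr cl _ _ _; nlia.
have [|le1 eq1] := @tight_extremal t (G n.-1 t) ltac:(nlia); first by rewrite sum1.
split=> // /eq1[tight]; rewrite sum1 => eqekr.
have [||X dX def_star] := layer_star cl _ _ eqekr; [by nlia|by nlia|].
have [B BF dB] : exists2 B, B \in fam & \dim B = t.+1.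
  by apply: layer_neq0; rewrite eqekr gt_eqF // gauss_gt0 ?q1 //; nlia.
have lt2t : (t.*2 < n)%N by nlia.
have lows := low_layers_full len lt2t tight (no_far_pair len BF dB).
split=> //; exists X => //; apply/setP => A; rewrite in_setU -def_star.
apply/idP/orP => [AF|[/bigcupP[k _ Ak]|]]; last by rewrite in_layer => /andP[].
  have [leA|gtA] := leqP (\dim A) t.
    left; apply/bigcupP.
    by exists (Ordinal (leA : \dim A < t.+1)%N); rewrite ?in_subspaces.
  have [eA|neA] := eqVneq (\dim A) t.+1; first by right; rewrite in_layer AF eA /=.
  have := nohigh A AF; rewrite (_ : t.+1 < \dim A)%N; last first.
    by move: gtA neA; clear; lia.
  rewrite /= -leqNgt => leA.
  have [|_ empty] := lows (n - \dim A)%N; first by move: leA; clear; lia.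
  have := in_set0 A; rewrite -empty in_layer AF subKn ?eqxx //.
  exact: dim_le.
have [full _] := lows k (ltn_ord k).
by move: Ak; rewrite -full in_layer => /andP[].
Qed.

End Close.
End Extremal.

(** * The bound and its equality cases by parity of d *)

Section Main.
Variables (F : finFieldType) (n d : nat) (b : {biscalar 'rV[F]_n}).
Hypothesis nondeg : nondegenerate_form b.
Local Notation V := 'rV[F]_n.
Local Notation q := #|F|.
Local Notation G := (gauss_binom q).
Local Notation q1 := (card_field_gt1 F).
Implicit Types (fam : {set {vspace V}}).

(** One direction of the equivalence only; the converse is [extremal_card]. *)
Definition solved fam := #|fam|%:R <= diam_bound F n d
  /\ (#|fam|%:R = diam_bound F n d ->
      extremal d fam \/ extremal d (perp_family b fam)).

(** With n = d + 1 the range t < k < n - t is empty for d = 2t and is the single layer t + 1 for d =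
    2t + 1, where n = 2(t + 1) is just large enough for [layer_ekr]. *)
Lemma solved_small fam : close d fam -> n = d.+1 -> solved fam.
Proof.
move=> cl def_n; have ltdn : (d < n)%N by nlia.
have [|] := boolP (odd d) => od.
  have def_d : d = (2 * d./2).+1 by rewrite -{1}(odd_double_half d) od mul2n.
  set t := d./2 in def_d; rewrite /solved (diam_bound_odd F n def_d).
  have sum1 : \sum_(t.+1 <= k < n - t) #|layer fam k|%:R = #|layer fam t.+1|%:R :> rat.
    by rewrite (_ : n - t = t.+2)%N; [exact: big_nat1 | nlia].
  have ekr : #|layer fam t.+1|%:R <= G n.-1 t by apply: layer_ekr cl _ _ _; nlia.
  have [|le1 eq1] := @tight_extremal _ _ _ _ cl ltdn t (G n.-1 t) ltac:(nlia).
    by rewrite sum1.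
  split=> // /eq1[tight]; rewrite sum1 => eqekr; left; exists t; apply: Or42; split=> //.
    by move=> k lek; apply: (pair_one_of_two cl ltdn); [nlia | exact: tight].
  have := @layer_intersecting _ _ _ _ cl t t.+1 ltac:(nlia) (ltnSn t).
  by rewrite subSnn.
have def_d : d = (2 * d./2)%N by rewrite -{1}(odd_double_half d) (negPf od) mul2n.
set t := d./2 in def_d; rewrite /solved (diam_bound_even F n def_d).
have [|le1 eq1] := @tight_extremal _ _ _ _ cl ltdn t 0 ltac:(nlia).
  by rewrite big_geq //; nlia.
rewrite addr0 in le1 eq1; split=> // /eq1[tight _]; left; exists t; apply: Or41; split=> //.
by move=> k lek; apply: (pair_one_of_two cl ltdn); [nlia | exact: tight].
Qed.

Lemma perp_dims fam t t' : (t' <= n)%N -> (t <= n)%N ->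
  (forall A, A \in fam -> ~~ (t < \dim A < t')%N) ->
  forall A, A \in perp_family b fam -> ~~ (n - t' < \dim A < n - t)%N.
Proof.
move=> let' let1 noA _ /imsetP[A AF ->]; rewrite dim_perp //.
by have := noA A AF; have := dim_le A; move: let' let1; clear; lia.
Qed.

Lemma core_lt_card fam t x : close d fam -> (d < n)%N -> (t.*2 < n)%N ->
  core fam t < G n t + x -> #|fam|%:R < \sum_(i < t.+1) G n i + x.
Proof.
move=> cl ltdn lt2t; rewrite /core (card_fam_ends fam lt2t) !big_ord_recr /= => ltc.
have : \sum_(i < t) (#|layer fam i|%:R + #|layer fam (n - i)|%:R) <= \sum_(i < t) G n i.
  apply: ler_sum => i _; apply: layer_pair cl _ _ _ => //.
  by have := ltn_ord i; nlia.
by lra.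
Qed.

(** A middle member makes the bound strict. Otherwise equality makes one of the layers t and n - t
    full, and which one decides between the family and its perp. *)
Lemma solved_even fam t : close d fam -> (d.+2 <= n)%N -> d = (2 * t)%N ->
  (0 < t)%N -> solved fam.
Proof.
move=> cl len def_d t0; have ltdn : (d < n)%N by nlia.
have lt2t : (t.*2 < n)%N by nlia.
rewrite /solved (diam_bound_even F n def_d).
have [/existsP[B /andP[BF dB]]|/existsPn nomid] :=
    boolP [exists B, (B \in fam) && (t < \dim B < n - t)%N].
  have ltc : core fam t < G n t.
    case: t t0 def_d dB lt2t => // -[|s] _ def_d dB lt2t.
      by apply: core_even_one_lt nondeg _ cl _ _ BF _; nlia.
    by apply: core_even_lt nondeg _ cl _ _ _ _ _ BF _; nlia.
  have := @core_lt_card fam t 0 cl ltdn lt2t; rewrite !addr0 => /(_ ltc) lt1.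
  by split; [exact: ltW | move/eqP; rewrite lt_eqF].
have nomid' A : A \in fam -> ~~ (t < \dim A < n - t)%N.
  by move=> AF; have := nomid A; rewrite AF.
have sum0 : \sum_(t.+1 <= k < n - t) #|layer fam k|%:R <= 0 :> rat.
  rewrite big_nat big1 // => k hk; apply: layer_eq0 => A AF.
  by apply: contraNneq (nomid' A AF) => ->.
have [le1 eq1] := tight_extremal cl ltdn lt2t sum0.
rewrite addr0 in le1 eq1; split=> // /eq1[tight _].
have [full|nfull] := eqVneq (layer fam (n - t)) (subspaces F n (n - t)); last first.
  by left; exists t; apply: Or43; apply: extremal_even_low cl ltdn _ len def_d nomid' tight nfull.
right; exists t; apply: Or43.
have cl' := close_perp nondeg cl.
have layE k : (k <= n)%N -> #|layer (perp_family b fam) k| = #|layer fam (n - k)|.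
  exact: card_layer_perp.
apply: (extremal_even_low cl' ltdn len def_d) => [A AF|i lei|].
- have := @perp_dims fam t (n - t) ltac:(nlia) ltac:(nlia) nomid' A AF.
  by rewrite subKn //; nlia.
- rewrite !layE ?subKn ?leq_subr //; [|by nlia..].
  by rewrite addrC tight.
(* The layers t and n - t cannot both be full: their sizes would add up to 2[n,t]. *)
apply/eqP => full'; have := tight t (leqnn t).
rewrite full card_subspaces gauss_sym ?q1 //; last by nlia.
have := layE (n - t)%N (leq_subr _ _); rewrite full' subKn; last by nlia.
move/(congr1 (fun m : nat => m%:R : rat)); rewrite card_subspaces => <-.
rewrite gauss_sym ?q1 //; last by nlia.
have : 0 < G n t by rewrite gauss_gt0 ?q1 //; nlia.
by lra.
Qed.

(** Without members of dimension t + 2 to n - t - 1, [odd_low] applies; without members of dimension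
    t + 1 to n - t - 2, it applies to the perps. Otherwise witnesses B and B' feed [core_odd_lt],
    except for t = 1 with a member of dimension 3 to n - 3, where [core_odd_one_lt] takes over. *)
Lemma solved_odd fam t : close d fam -> (d.+2 <= n)%N -> d = (2 * t).+1 ->
  (0 < t)%N -> solved fam.
Proof.
move=> cl len def_d t0; have ltdn : (d < n)%N by nlia.
have lt2t : (t.*2 < n)%N by nlia.
have [/existsP[B /andP[BF dB]]|/existsPn nohigh] :=
    boolP [exists B, (B \in fam) && (t.+1 < \dim B < n - t)%N]; last first.
  have [|le1 eq1] := odd_low cl ltdn len def_d.
    by move=> A AF; have := nohigh A; rewrite AF.
  by split=> // /eq1 ex4; left; exists t; apply: Or44.
have [/existsP[B' /andP[B'F dB']]|/existsPn nolow] :=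
    boolP [exists B, (B \in fam) && (t < \dim B < n - t.+1)%N]; last first.
  have cl' := close_perp nondeg cl.
  have nolow' A : A \in fam -> ~~ (t < \dim A < n - t.+1)%N.
    by move=> AF; have := nolow A; rewrite AF.
  have [|le1 eq1] := odd_low cl' ltdn len def_d.
    move=> A AF; have := @perp_dims fam t (n - t.+1) ltac:(nlia) ltac:(nlia) nolow' A AF.
    by rewrite subKn //; nlia.
  rewrite card_perp_family // in le1 eq1.
  by split=> // /eq1 ex4; right; exists t; apply: Or44.
have ltc : core fam t < G n t + G n.-1 t.
  case: t t0 def_d dB dB' lt2t => // s _ def_d dB dB' lt2t.
  have [m1|nm] := boolP ((0 < s)%N || ~~ [exists A in fam, (s.+3 <= \dim A < n - s.+2)%N]).
    by apply: core_odd_lt nondeg _ cl _ _ _ m1 _ _ BF _ B'F _; nlia.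
  move: nm; rewrite negb_or negbK -leqNgt leqn0 => /andP[/eqP s0 /exists_inP[A AF dA]].
  rewrite s0 in def_d dA *.
  by apply: core_odd_one_lt nondeg _ cl _ _ AF _; nlia.
rewrite /solved (diam_bound_odd F n def_d).
have lt1 := core_lt_card cl ltdn lt2t ltc.
by split; [exact: ltW | move/eqP; rewrite lt_eqF].
Qed.

End Main.

Theorem theorem1p2 (F : finFieldType) (n d : nat) (b : {biscalar 'rV[F]_n})
    (fam : {set {vspace 'rV[F]_n}})
    (hd : (3 <= d.+1)%N) (hn : (d.+1 <= n)%N) (hb : nondegenerate_form b)
    (hdiam : (diam fam <= d)%N) :
  #|fam|%:R <= diam_bound F n d
  /\ (#|fam|%:R = diam_bound F n d <->
      extremal d fam \/ extremal d (perp_family b fam)).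
Proof.
have cl := diam_close hdiam.
have [le1 eq1] : solved d b fam.
  have [le_n|gt_n] := leqP n d.+1; first by apply: solved_small => //; nlia.
  have t0 : (0 < d./2)%N by rewrite half_gt0.
  have [od|od] := boolP (odd d).
    by apply: (solved_odd hb cl gt_n _ t0); rewrite -{1}(odd_double_half d) od mul2n.
  apply: (solved_even hb cl gt_n _ t0).
  by rewrite -{1}(odd_double_half d) (negPf od) mul2n.
split=> //; split=> [/eq1 //|[/extremal_card //|/extremal_card]].
by rewrite card_perp_family.
Qed.
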